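(* Let $R$ be a commutative Noetherian domain. If $\mathsf D_{\mathsf{sg}}(R)$ has a strong generator, then $\mathrm{ann}_R\mathsf D_{\mathsf{sg}}(R)\neq0$.
   Context: $\mathsf D^f(R)$ is the full subcategory of the derived category $\mathsf D(R)$ of $R$-modules formed by complexes whose total cohomology $\bigoplus_iH^i(X)$ is finitely generated, and $\mathsf D_{\mathsf{sg}}(R)=\mathsf D^f(R)/\mathrm{thick}_{\mathsf D(R)}(R)$ is the Verdier quotient by the perfect complexes. $\mathrm{ann}_R\mathsf D_{\mathsf{sg}}(R)=\bigcap_{X\in\mathsf D_{\mathsf{sg}}(R)}\{r\in R\mid r\cdot\mathrm{Hom}_{\mathsf D_{\mathsf{sg}}(R)}(X,X)=0\}$. For an object $X$ of a triangulated category $\mathcal T$: $\mathrm{thick}^0_{\mathcal T}(X)=\{0\}$; $\mathrm{thick}^1_{\mathcal T}(X)$ is the smallest full subcategory containing $X$ and closed under suspensions, finite direct sums and direct summands; for $n\ge2$, $\mathrm{thick}^n_{\mathcal T}(X)$ consists of the objects $Y$ appearing in an exact triangle $Y_1\to Y\oplus Y'\to Y_2\to Y_1[1]$ with $Y_1\in\mathrm{thick}^{n-1}_{\mathcal T}(X)$, $Y_2\in\mathrm{thick}^1_{\mathcal T}(X)$. $G$ is a strong generator of $\mathcal T$ if $\mathcal T=\mathrm{thick}^n_{\mathcal T}(G)$ for some $n\ge0$. *)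

(* Defs.v *)
From HB Require Import structures.
From mathcomp Require Import all_boot all_order all_algebra zify.

Set Implicit Arguments.
Unset Strict Implicit.
Unset Printing Implicit Defensive.

Import GRing.Theory.
Local Open Scope ring_scope.

Definition is_ideal (R : comNzRingType) (I : R -> Prop) : Prop :=
  [/\ I 0, forall x y, I x -> I y -> I (x + y) & forall a x, I x -> I (a * x)].

Definition noetherian (R : comNzRingType) : Prop :=
  forall I : R -> Prop, is_ideal I ->
  exists (n : nat) (g : 'I_n -> R),
    (forall k, I (g k)) /\
    (forall x, I x -> exists a : 'I_n -> R, x = \sum_k a k * g k).

(* The records below only package data: the categories that occur in this     *)
(* file are constructed explicitly, and their laws are theorems about them.   *)
(* Hom-sets are setoids: [heq f g] is equality of the morphisms f and g.      *)
(* Only the part of the R-linear structure that is used is recorded, namely   *)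
(* zero morphisms and the action of R.                                        *)

Record lincat (R : comNzRingType) := LinCat {
  ob :> Type;
  hom : ob -> ob -> Type;
  heq : forall X Y, hom X Y -> hom X Y -> Prop;
  idm : forall X, hom X X;
  compm : forall X Y Z, hom Y Z -> hom X Y -> hom X Z;
  zerom : forall X Y, hom X Y;
  scalem : forall X Y, R -> hom X Y -> hom X Y;
  dsum : ob -> ob -> ob;
  shift : ob -> ob;
  shiftm : forall X Y, hom X Y -> hom (shift X) (shift Y) }.

Arguments hom {R l} X Y.
Arguments heq {R l X Y} f g.
Arguments idm {R l} X.
Arguments compm {R l X Y Z} g f.
Arguments zerom {R l} X Y.
Arguments scalem {R l X Y} r f.
Arguments dsum {R l} X Y.
Arguments shift {R l} X.
Arguments shiftm {R l X Y} f.

Section LinCat.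
Variables (R : comNzRingType) (C : lincat R).
Implicit Types X Y Z : C.

Definition is_inverse X Y (f : hom X Y) (g : hom Y X) : Prop :=
  heq (compm g f) (idm X) /\ heq (compm f g) (idm Y).

Definition is_iso X Y (f : hom X Y) : Prop := exists g, is_inverse f g.

Definition isomorphic X Y : Prop := exists f : hom X Y, is_iso f.

Definition is_zero X : Prop := heq (idm X) (zerom X X).

Definition is_summand Y Z : Prop := exists Y', isomorphic Z (dsum Y Y').

(* Isomorphism of the triangles X -> Y -> Z -> X[1] and X' -> Y' -> Z' -> X'[1]. *)
Definition tri_iso
    X Y Z (f : hom X Y) (g : hom Y Z) (h : hom Z (shift X))
    X' Y' Z' (f' : hom X' Y') (g' : hom Y' Z') (h' : hom Z' (shift X')) : Prop :=
  exists (a : hom X X') (b : hom Y Y') (c : hom Z Z'),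
    [/\ is_iso a, is_iso b & is_iso c] /\
    [/\ heq (compm b f) (compm f' a),
        heq (compm c g) (compm g' b)
      & heq (compm (shiftm a) h) (compm h' c)].

End LinCat.

Record tricat (R : comNzRingType) := TriCat {
  tri_lincat :> lincat R;
  exact_tri : forall X Y Z : tri_lincat,
    hom X Y -> hom Y Z -> hom Z (shift X) -> Prop }.

Arguments exact_tri {R t X Y Z} f g h.

Section Generation.
Variables (R : comNzRingType) (T : tricat R).

(* Thick = full, triangulated, closed under direct summands. Closure under    *)
(* isomorphism is the case Y' = 0 of summands; the shift clause is an         *)
(* equivalence because it covers both [1] and its inverse [-1]; the other     *)
(* two-out-of-three properties follow by rotation.                            *)
Definition is_thick (P : T -> Prop) : Prop :=
  [/\ forall X, is_zero X -> P X,
      forall X, P X <-> P (shift X),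
      forall X Y Z (f : hom X Y) (g : hom Y Z) (h : hom Z (shift X)),
        exact_tri f g h -> P X -> P Y -> P Z
    & forall Y Z, is_summand Y Z -> P Z -> P Y].

Definition thick (G X : T) : Prop :=
  forall P : T -> Prop, is_thick P -> P G -> P X.

Inductive thick1 (G : T) : T -> Prop :=
| thick1_gen : thick1 G G
| thick1_shift X : thick1 G X -> thick1 G (shift X)
| thick1_unshift X : thick1 G (shift X) -> thick1 G X
| thick1_zero X : is_zero X -> thick1 G X
| thick1_dsum X Y : thick1 G X -> thick1 G Y -> thick1 G (dsum X Y)
| thick1_summand Y Z : is_summand Y Z -> thick1 G Z -> thick1 G Y.

Fixpoint thickn (n : nat) (G Y : T) : Prop :=
  match n with
  | 0 => is_zero Y
  | m.+1 =>
    match m with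
    | 0 => thick1 G Y
    | _ => exists (Y1 Y' Y2 : T) (f : hom Y1 (dsum Y Y'))
             (g : hom (dsum Y Y') Y2) (h : hom Y2 (shift Y1)),
           [/\ exact_tri f g h, thickn m G Y1 & thick1 G Y2]
    end
  end.

Definition strong_generator (G : T) : Prop :=
  exists n : nat, forall Y : T, thickn n G Y.

Definition annihilator (r : R) : Prop :=
  forall (X : T) (f : hom X X), heq (scalem r f) (zerom X X).

End Generation.

Section FullSub.
Variables (R : comNzRingType) (T : tricat R) (P : T -> Prop).
Hypothesis P_dsum : forall X Y, P X -> P Y -> P (dsum X Y).
Hypothesis P_shift : forall X, P X -> P (shift X).

Definition full_sub_lincat : lincat R :=
  @LinCat R {X : T | P X}
    (fun X Y => hom (sval X) (sval Y))
    (fun X Y f g => heq f g)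
    (fun X => idm (sval X))
    (fun X Y Z g f => compm g f)
    (fun X Y => zerom (sval X) (sval Y))
    (fun X Y r f => scalem r f)
    (fun X Y => exist _ (dsum (sval X) (sval Y)) (P_dsum (svalP X) (svalP Y)))
    (fun X => exist _ (shift (sval X)) (P_shift (svalP X)))
    (fun X Y f => shiftm f).

Definition full_sub : tricat R :=
  @TriCat R full_sub_lincat (fun X Y Z f g h => exact_tri f g h).

End FullSub.

(* T / N is the Gabriel-Zisman localization of T at the morphisms with cone   *)
(* in N: same objects, and morphisms are formal composites of morphisms of T  *)
(* and formal inverses, modulo the relations of a category, functoriality of  *)
(* the localization functor [loc_in], and the inverse laws. A triangle is     *)
(* exact when it is isomorphic to the image of an exact triangle of T.        *)

Section Verdier.
Variables (R : comNzRingType) (T : tricat R) (N : T -> Prop).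

(* When T is triangulated and N is closed under shift, [has_cone_shift] adds  *)
(* nothing: (f[1], g[1], -h[1]) is exact if (f, g, h) is. It lets the shift   *)
(* act on formal inverses.                                                    *)
Inductive has_cone_in : forall X Y : T, hom X Y -> Prop :=
| has_cone X Y Z (f : hom X Y) (g : hom Y Z) (h : hom Z (shift X)) :
    exact_tri f g h -> N Z -> has_cone_in f
| has_cone_shift X Y (f : hom X Y) : has_cone_in f -> has_cone_in (shiftm f).

Inductive loc_hom : T -> T -> Type :=
| loc_in X Y : hom X Y -> loc_hom X Y
| loc_inv X Y (s : hom X Y) : has_cone_in s -> loc_hom Y X
| loc_comp X Y Z : loc_hom Y Z -> loc_hom X Y -> loc_hom X Z.

Inductive loc_eq : forall X Y : T, loc_hom X Y -> loc_hom X Y -> Prop :=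
| loc_eq_refl X Y (p : loc_hom X Y) : loc_eq p p
| loc_eq_sym X Y (p q : loc_hom X Y) : loc_eq p q -> loc_eq q p
| loc_eq_trans X Y (p q r : loc_hom X Y) : loc_eq p q -> loc_eq q r -> loc_eq p r
| loc_eq_comp X Y Z (p p' : loc_hom Y Z) (q q' : loc_hom X Y) :
    loc_eq p p' -> loc_eq q q' -> loc_eq (loc_comp p q) (loc_comp p' q')
| loc_eq_assoc X Y Z V (p : loc_hom Z V) (q : loc_hom Y Z) (r : loc_hom X Y) :
    loc_eq (loc_comp p (loc_comp q r)) (loc_comp (loc_comp p q) r)
| loc_eq_idl X Y (p : loc_hom X Y) : loc_eq (loc_comp (loc_in (idm Y)) p) p
| loc_eq_idr X Y (p : loc_hom X Y) : loc_eq (loc_comp p (loc_in (idm X))) p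
| loc_eq_in X Y (f g : hom X Y) : heq f g -> loc_eq (loc_in f) (loc_in g)
| loc_eq_in_comp X Y Z (g : hom Y Z) (f : hom X Y) :
    loc_eq (loc_in (compm g f)) (loc_comp (loc_in g) (loc_in f))
| loc_eq_invl X Y (s : hom X Y) (w : has_cone_in s) :
    loc_eq (loc_comp (loc_inv w) (loc_in s)) (loc_in (idm X))
| loc_eq_invr X Y (s : hom X Y) (w : has_cone_in s) :
    loc_eq (loc_comp (loc_in s) (loc_inv w)) (loc_in (idm Y)).

Fixpoint loc_shift X Y (p : loc_hom X Y) : loc_hom (shift X) (shift Y) :=
  match p in loc_hom X Y return loc_hom (shift X) (shift Y) with
  | loc_in _ _ f => loc_in (shiftm f)
  | loc_inv _ _ _ w => loc_inv (has_cone_shift w)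
  | loc_comp _ _ _ p q => loc_comp (loc_shift p) (loc_shift q)
  end.

(* The localization functor is R-linear, so r acts on a morphism to Y as the  *)
(* image of r times the identity of Y does by composition; and it preserves   *)
(* direct sums and zero morphisms.                                            *)
Definition verdier_lincat : lincat R :=
  @LinCat R T loc_hom loc_eq
    (fun X => loc_in (idm X))
    loc_comp
    (fun X Y => loc_in (zerom X Y))
    (fun X Y r p => loc_comp (loc_in (scalem r (idm Y))) p)
    (fun X Y => dsum X Y)
    (fun X => shift X)
    loc_shift.

Definition verdier : tricat R :=
  @TriCat R verdier_lincat (fun X Y Z p q r =>
    exists (X' Y' Z' : T) (f : hom X' Y') (g : hom Y' Z') (h : hom Z' (shift X')),
      exact_tri f g h /\
      tri_iso (C := verdier_lincat) (loc_in f) (loc_in g) (loc_in h) p q r).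

End Verdier.


#[local] Obligation Tactic := idtac.

Section Complexes.
Variable R : comNzRingType.

Definition mk_linear (U V : lmodType R) (f : U -> V) (Hf : linear f) :
    {linear U -> V} :=
  HB.pack f (GRing.isLinear.Build R U V *:%R f Hf).

Record cplx := Cplx {
  cplx_mod :> int -> lmodType R;
  diff : forall i : int, {linear cplx_mod i -> cplx_mod (i + 1)};
  diffK : forall (i : int) x, diff (i + 1) (diff i x) = 0 }.

Arguments diff : clear implicits.

Record chain_map (X Y : cplx) := ChainMap {
  cm_fun :> forall i : int, {linear X i -> Y i};
  cm_diff : forall (i : int) x, cm_fun (i + 1) (diff X i x) = diff Y i (cm_fun i x) }.

(* The component of the homotopy in degree i + 1 is called h i. Every degree  *)
(* is of the form i + 1.                                                      *)
Definition homotopic X Y (f g : chain_map X Y) : Prop :=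
  exists h : forall i : int, {linear X (i + 1) -> Y i}, forall (i : int) x,
    f (i + 1) x - g (i + 1) x = diff Y i (h i x) + h (i + 1) (diff X (i + 1) x).

Program Definition cm_id X : chain_map X X :=
  @ChainMap X X (fun i : int => idfun) _.
Next Obligation. by []. Qed.

Program Definition cm_comp X Y Z (g : chain_map Y Z) (f : chain_map X Y) :
    chain_map X Z :=
  @ChainMap X Z (fun i : int => g i \o f i) _.
Next Obligation. by move=> X Y Z g f i x; rewrite /= !cm_diff. Qed.

Program Definition cm_zero X Y : chain_map X Y := @ChainMap X Y (fun i : int => \0) _.
Next Obligation. by move=> X Y i x; rewrite /= linear0. Qed.

Program Definition cm_scale X Y (r : R) (f : chain_map X Y) : chain_map X Y :=
  @ChainMap X Y (fun i : int => r \*: f i) _.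
Next Obligation. by move=> X Y r f i x; rewrite /= cm_diff linearZ. Qed.

Section DirectSum.
Variables X Y : cplx.

Definition dsum_diff_fun (i : int) (x : X i * Y i) : X (i + 1) * Y (i + 1) :=
  (diff X i x.1, diff Y i x.2).

Fact dsum_diff_linear (i : int) : linear (@dsum_diff_fun i).
Proof. by move=> a x y; rewrite /dsum_diff_fun /= !linearP. Qed.

Program Definition cplx_dsum : cplx :=
  @Cplx (fun i : int => (X i * Y i)%type) (fun i : int => mk_linear (@dsum_diff_linear i)) _.
Next Obligation. by move=> i x; rewrite /= /dsum_diff_fun /= !diffK. Qed.

End DirectSum.

Program Definition cplx_shift (X : cplx) : cplx :=
  @Cplx (fun i : int => X (i + 1)) (fun i : int => \- (diff X (i + 1))) _.
Next Obligation. by move=> X i x; rewrite /= linearN opprK diffK. Qed.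

Program Definition cm_shift X Y (f : chain_map X Y) :
    chain_map (cplx_shift X) (cplx_shift Y) :=
  @ChainMap (cplx_shift X) (cplx_shift Y) (fun i : int => f (i + 1)) _.
Next Obligation. by move=> X Y f i x; rewrite /= linearN cm_diff. Qed.

Section Cone.
Variables (X Y : cplx) (f : chain_map X Y).

Definition cone_diff_fun (i : int) (x : X (i + 1) * Y i) : X (i + 1 + 1) * Y (i + 1) :=
  (- diff X (i + 1) x.1, f (i + 1) x.1 + diff Y i x.2).

Fact cone_diff_linear (i : int) : linear (@cone_diff_fun i).
Proof.
move=> a x y; rewrite /cone_diff_fun.
by congr (_, _); rewrite /= !linearP /= ?opprD ?scalerN // scalerDr addrACA.
Qed.

Program Definition cone : cplx :=
  @Cplx (fun i : int => (X (i + 1)%R * Y i)%type)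
    (fun i : int => mk_linear (@cone_diff_linear i)) _.
Next Obligation.
move=> i x; rewrite /= /cone_diff_fun /=; congr (_, _).
  by rewrite linearN opprK diffK.
by rewrite linearN linearD cm_diff diffK addr0 addNr.
Qed.

Fact cone_in_linear (i : int) : linear (fun y : Y i => (0, y) : X (i + 1) * Y i).
Proof. by move=> a x y; congr (_, _); rewrite /= scaler0 addr0. Qed.

Program Definition cone_in : chain_map Y cone :=
  @ChainMap Y cone (fun i : int => mk_linear (@cone_in_linear i)) _.
Next Obligation.
move=> i y; rewrite /= /cone_diff_fun /=; congr (_, _).
  by rewrite linear0 oppr0.
by rewrite linear0 add0r.
Qed.

Fact cone_out_linear (i : int) : linear (fun x : X (i + 1) * Y i => x.1).
Proof. by []. Qed.

Program Definition cone_out : chain_map cone (cplx_shift X) :=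
  @ChainMap cone (cplx_shift X) (fun i : int => mk_linear (@cone_out_linear i)) _.
Next Obligation. by []. Qed.

End Cone.

Definition homotopy_lincat : lincat R :=
  @LinCat R cplx chain_map homotopic cm_id cm_comp cm_zero cm_scale
    cplx_dsum cplx_shift cm_shift.

Definition homotopy_category : tricat R :=
  @TriCat R homotopy_lincat (fun X Y Z f g h =>
    exists (X' Y' : cplx) (u : chain_map X' Y'),
      tri_iso (C := homotopy_lincat) u (cone_in u) (cone_out u) f g h).

Definition acyclic (X : cplx) : Prop :=
  forall (i : int) (x : X (i + 1)), diff X (i + 1) x = 0 -> exists y, diff X i y = x.

Definition derived_category : tricat R := verdier (T := homotopy_category) acyclic.

(* The direct sum of the H^i(X) is the module of finitely supported families  *)
(* of cocycles modulo the families all of whose components are coboundaries.  *)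
Definition cocycle_family (X : cplx) (z : forall i : int, X i) : Prop :=
  (forall i : int, diff X i (z i) = 0) /\
  (exists N : nat, forall i : int, (N < `|i|)%N -> z i = 0).

Definition fg_total_cohomology (X : cplx) : Prop :=
  exists (n : nat) (g : 'I_n -> forall i : int, X i),
    (forall k, cocycle_family (g k)) /\
    (forall z, cocycle_family z -> exists a : 'I_n -> R,
       forall i : int, exists y,
         z (i + 1) = \sum_k a k *: g k (i + 1) + diff X i y).

Fact fg_total_cohomology_dsum (X Y : cplx) :
  fg_total_cohomology X -> fg_total_cohomology Y ->
  fg_total_cohomology (cplx_dsum X Y).
Proof.
move=> [m [g [Hg Gg]]] [n [h [Hh Gh]]].
pose k0 (k : 'I_(m + n)) (i : int) : cplx_dsum X Y i :=
  match split k with inl a => (g a i, 0) | inr b => (0, h b i) end.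
exists (m + n)%N, k0; split=> [k|z [dz [N zN]]].
  rewrite /k0; case: (split k) => a; split.
  - by move=> i; rewrite /= /dsum_diff_fun /= (Hg a).1 linear0.
  - by have [_ [N HN]] := Hg a; exists N => i /HN->.
  - by move=> i; rewrite /= /dsum_diff_fun /= (Hh a).1 linear0.
  - by have [_ [N HN]] := Hh a; exists N => i /HN->.
have [a Ha] : exists a : 'I_m -> R, forall i : int, exists y,
    (z (i + 1)).1 = \sum_k a k *: g k (i + 1) + diff X i y.
  apply: (Gg (fun i : int => (z i).1)); split=> [i|].
    exact: (congr1 fst (dz i)).
  by exists N => i /zN->.
have [b Hb] : exists b : 'I_n -> R, forall i : int, exists y,
    (z (i + 1)).2 = \sum_k b k *: h k (i + 1) + diff Y i y.
  apply: (Gh (fun i : int => (z i).2)); split=> [i|].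
    exact: (congr1 snd (dz i)).
  by exists N => i /zN->.
exists (fun k => match split k with inl k => a k | inr k => b k end) => i.
have [[y Hy] [y' Hy']] := (Ha i, Hb i); exists (y, y').
have E1 (u v : X (i + 1) * Y (i + 1)) : u.1 = v.1 -> u.2 = v.2 -> u = v.
  by case: u v => [? ?] [? ?] /= -> ->.
rewrite big_split_ord /=; under eq_bigr => k _ do rewrite /k0 !(unsplitK (inl k)).
under [X in _ + X + _]eq_bigr => k _ do rewrite /k0 !(unsplitK (inr k)).
apply: E1 => /=.
  rewrite Hy; congr (_ + _).
  rewrite !raddf_sum /= [\sum_(_ < n) _]big1 ?addr0 // => k _; exact: scaler0.
rewrite Hy'; congr (_ + _).
rewrite !raddf_sum /= [\sum_(_ < m) _]big1 ?add0r // => k _; exact: scaler0.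
Qed.

Fact fg_total_cohomology_shift (X : cplx) :
  fg_total_cohomology X -> fg_total_cohomology (cplx_shift X).
Proof.
move=> [n [g [Hg Gg]]].
have pK (i : int) : i - 1 + 1 = i by rewrite subrK.
exists n, (fun k (i : int) => g k (i + 1)); split=> [k|z [dz [N zN]]].
  have [dg [N gN]] := Hg k; split=> [i|]; first by rewrite /= dg oppr0.
  exists N.+1 => i Hi; apply: gN; lia.
pose z' (i : int) : X i := ecast j (X j) (pK i) (z (i - 1)).
have z'E i : z' (i + 1) = z i.
  have e : i + 1 - 1 = i by rewrite addrK.
  rewrite /z'; move: (pK _); rewrite e => e'.
  by rewrite (eq_irrelevance e' (erefl _)).
have pP (P : int -> Prop) : (forall i : int, P (i + 1)) -> forall i : int, P i.
  by move=> H i; rewrite -(pK i); apply: H.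
have [a Ha] : exists a : 'I_n -> R, forall i : int, exists y,
    z' (i + 1) = \sum_k a k *: g k (i + 1) + diff X i y.
  apply: Gg; split.
    by apply: pP => i; rewrite z'E; apply: oppr_inj; rewrite oppr0; apply: dz.
  exists N.+1; apply: pP => i Hi; rewrite z'E; apply: zN; lia.
exists a => i; have [y Hy] := Ha (i + 1); exists (- y).
by rewrite -[z _]z'E Hy /= linearN opprK.
Qed.

Definition derived_category_f : tricat R :=
  @full_sub R derived_category fg_total_cohomology
    fg_total_cohomology_dsum fg_total_cohomology_shift.

Definition ring_mod (i : int) : lmodType R :=
  if i == 0 then (R^o : lmodType R) else ('rV[R]_0 : lmodType R).

Program Definition ring_cplx : cplx := @Cplx ring_mod (fun i : int => \0) _.
Next Obligation. by []. Qed.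

Definition singularity_category : tricat R :=
  verdier (T := derived_category_f)
    (fun X => thick (T := derived_category) ring_cplx (sval X)).

End Complexes.

(* Main.v *)
Require Import Defs.
From HB Require Import structures.
From mathcomp Require Import all_boot all_order all_algebra.
From mathcomp Require Import zify boolp.
Import Order.TTheory GRing.Theory Num.Theory.
Local Open Scope ring_scope.

(** Say that [r] kills an object when it annihilates the identity of that object
    in the singularity category. In an exact triangle X -> Y -> Z -> X[1], if [r]
    kills X and [s] kills Z, then [s * r] kills Y ([kills_extension]): a map out of
    Y, multiplied by [r], vanishes on X and so factors through Z, where [s] kills
    it. If some [r != 0] kills a generator G and every object is in the n-th
    thickening of G, then [r ^+ n], which is nonzero in a domain, kills everything
    ([kills_thickn]).

    A nonzero scalar killing a complex G with finitely generated cohomology is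
    found as follows ([kills_fgH]). Take finitely many homogeneous generators of the
    cohomology. If a generator z of degree i is not torsion, then 1 |-> z is a map
    R[-i] -> G injective on cohomology; its cone has one generator less, and it is
    isomorphic to G in the singularity category because R[-i] is perfect. When all
    the remaining generators are torsion, one nonzero scalar kills the whole
    cohomology, which is bounded, and an induction on truncations shows that a
    power of it kills the complex already in the derived category
    ([kills_torsion]).

    The singularity category is a localization of a full subcategory of a
    localization of the homotopy category, and its morphisms are formal zigzags.
    To compute in it, let N be the class of perfect complexes with finitely
    generated cohomology, and call a chain map weak if its cone is in N. The weak
    maps admit a calculus of left fractions: there are homotopy pushouts
    ([wk_po_inr]), and a map that vanishes on the source of a weak map is killed by
    a weak map ([wk_kill]). Hence the pairs (V, u : X -> V), two of them being
    identified when weak maps make them homotopic, form a functor of X that turns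
    weak maps into bijections and exact triangles into exact sequences. Such a
    functor extends along both localizations ([loc_rrep], [sing_representation]).
    On the other hand, [r] kills its value at X exactly when [r a] is null-homotopic
    for some weak map [a] out of X ([cplx_killsP]); since [a] is invertible in the
    singularity category, [r] is then zero on X there ([sing_kills_scale]).

    The same extension principle, applied to cohomology, shows that finite
    generation of cohomology is invariant under isomorphisms of the derived category
    ([fgH_iso]). That R is Noetherian is what makes the cone of a map between two
    such complexes again one ([fgH_cone]). *)

Set Implicit Arguments.
Unset Strict Implicit.
Unset Printing Implicit Defensive.

#[local] Obligation Tactic := idtac.

(** * Deciding identities between sums in an abelian group *)

(** Expressions over atoms given by their position in a list; two of them are equal
    in every abelian group once their integer coefficients agree. *)
Inductive zexp := ZVar of nat | ZZero | ZAdd of zexp & zexp | ZOpp of zexp.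

Fixpoint zeval (V : zmodType) (s : seq V) (e : zexp) : V :=
  match e with
  | ZVar k => s`_k
  | ZZero => 0
  | ZAdd a b => zeval s a + zeval s b
  | ZOpp a => - zeval s a
  end.

Fixpoint zcoef (e : zexp) (k : nat) : int :=
  match e with
  | ZVar j => (j == k)%:Z
  | ZZero => 0
  | ZAdd a b => zcoef a k + zcoef b k
  | ZOpp a => - zcoef a k
  end.

Lemma zeval_sum (V : zmodType) (s : seq V) (e : zexp) :
  zeval s e = \sum_(k < size s) s`_k *~ zcoef e k.
Proof.
elim: e => [j||a IHa b IHb|a IHa] /=.
- have [lt_js|le_sj] := ltnP j (size s).
    rewrite (bigD1 (Ordinal lt_js)) //= eqxx mulr1z big1 ?addr0 // => k.
    by rewrite -val_eqE /= eq_sym => /negbTE->.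
  rewrite nth_default // big1 // => k _.
  by rewrite gtn_eqF ?mulr0z // (leq_trans (ltn_ord k)).
- by rewrite big1 // => k _; rewrite mulr0z.
- by rewrite IHa IHb -big_split; apply: eq_bigr => k _; rewrite mulrzDr.
- by rewrite IHa -sumrN; apply: eq_bigr => k _; rewrite mulrNz.
Qed.

Lemma zeval_eq (V : zmodType) (s : seq V) (e1 e2 : zexp) :
  all (fun k => zcoef e1 k == zcoef e2 k) (iota 0 (size s)) ->
  zeval s e1 = zeval s e2.
Proof.
move=> /allP e12; rewrite !zeval_sum; apply: eq_bigr => k _.
by rewrite (eqP (e12 k _)) // mem_iota /=.
Qed.

(** The form in which an equation is used before calling the decision procedure. *)
Lemma zlin (V : zmodType) (a b x y : V) : a = b -> x + b = y + a -> x = y.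
Proof. by move=> -> /addIr. Qed.

Ltac zindex x s :=
  lazymatch s with
  | ?y :: ?s' => match constr:(tt) with
                 | _ => let _ := match constr:(tt) with _ => unify x y end in
                        constr:(O)
                 | _ => let k := zindex x s' in constr:(S k)
                 end
  end.

Ltac zatoms t s :=
  lazymatch t with
  | (?a + ?b)%R => let s1 := zatoms a s in zatoms b s1
  | (- ?a)%R => zatoms a s
  | 0%R => s
  | _ => match constr:(tt) with
         | _ => let _ := zindex t s in s
         | _ => constr:(t :: s)
         end
  end.

Ltac zreify t s :=
  lazymatch t with
  | (?a + ?b)%R => let x := zreify a s in let y := zreify b s in constr:(ZAdd x y)
  | (- ?a)%R => let x := zreify a s in constr:(ZOpp x)
  | 0%R => constr:(ZZero)
  | _ => let k := zindex t s in constr:(ZVar k)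
  end.

Ltac zmod :=
  lazymatch goal with
  | |- @eq ?T ?x ?y =>
    let s0 := zatoms x (@nil T) in
    let s := zatoms y s0 in
    let e1 := zreify x s in
    let e2 := zreify y s in
    apply: (@zeval_eq _ s e1 e2); vm_compute; reflexivity
  end.

(** For goals whose difference of sides is plus or minus that of [H]. *)
Ltac zuse H :=
  first [apply: (zlin H) => /=; zmod | apply: (zlin (esym H)) => /=; zmod].

Lemma pair_ext (A B : Type) (u v : A * B) : u.1 = v.1 -> u.2 = v.2 -> u = v.
Proof. by case: u v => [? ?] [? ?] /= -> ->. Qed.

Ltac pairs := do ?apply: pair_ext; rewrite /=.

(** * Chain maps up to homotopy *)

Section Homotopy.
Variable R : comNzRingType.
Implicit Types X Y Z V : cplx R.

Program Definition cm_sub X Y (f g : chain_map X Y) : chain_map X Y :=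
  @ChainMap R X Y (fun i : int => f i \- g i) _.
Next Obligation. by move=> X Y f g i x; rewrite /= !cm_diff linearB. Qed.

Lemma htp_ext X Y (f g : chain_map X Y) :
  (forall (i : int) x, f i x = g i x) -> homotopic f g.
Proof.
move=> e; exists (fun i => \0) => i x.
by rewrite /= e subrr linear0 addr0.
Qed.

Lemma htp_refl X Y (f : chain_map X Y) : homotopic f f.
Proof. exact: htp_ext. Qed.

Lemma htp_sym X Y (f g : chain_map X Y) : homotopic f g -> homotopic g f.
Proof.
case=> h H; exists (fun i => \- (h i)) => i x.
by rewrite -opprB H /= linearN opprD.
Qed.

Lemma htp_trans X Y (f g k : chain_map X Y) :
  homotopic f g -> homotopic g k -> homotopic f k.
Proof.
case=> h H [h' H']; exists (fun i => h i \+ h' i) => i x.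
by rewrite -[LHS](subrKA (g (i + 1) x)) H H' /= linearD addrACA.
Qed.

Lemma htp_comp X Y Z (g g' : chain_map Y Z) (f f' : chain_map X Y) :
  homotopic g g' -> homotopic f f' -> homotopic (cm_comp g f) (cm_comp g' f').
Proof.
case=> h H [k K]; apply: (@htp_trans _ _ _ (cm_comp g' f)).
  exists (fun i => h i \o f (i + 1)) => i x.
  by rewrite /= H -cm_diff.
exists (fun i => g' i \o k i) => i x.
by rewrite /= -linearB K linearD cm_diff.
Qed.

Lemma htp_compl X Y Z (g : chain_map Y Z) (f f' : chain_map X Y) :
  homotopic f f' -> homotopic (cm_comp g f) (cm_comp g f').
Proof. exact/htp_comp/htp_refl. Qed.

Lemma htp_compr X Y Z (g g' : chain_map Y Z) (f : chain_map X Y) :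
  homotopic g g' -> homotopic (cm_comp g f) (cm_comp g' f).
Proof. by move/htp_comp; apply; exact: htp_refl. Qed.

Lemma htp_scale X Y (r : R) (f g : chain_map X Y) :
  homotopic f g -> homotopic (cm_scale r f) (cm_scale r g).
Proof.
case=> h H; exists (fun i => r \*: h i) => i x.
by rewrite /= -scalerBr H scalerDr linearZ.
Qed.

Lemma htp_sub0 X Y (f g : chain_map X Y) :
  homotopic (cm_sub f g) (cm_zero X Y) <-> homotopic f g.
Proof.
by split; case=> h H; exists h => i x; move: (H i x); rewrite /= subr0.
Qed.

Lemma htp_shift X Y (f g : chain_map X Y) :
  homotopic f g -> homotopic (cm_shift f) (cm_shift g).
Proof.
case=> h H; exists (fun i => \- (h (i + 1))) => i x.
by rewrite /= H linearN opprK linearN opprK.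
Qed.

End Homotopy.

#[local] Hint Resolve htp_refl : core.

(** * Quasi-isomorphisms and cones *)

Section QuasiIso.
Variable R : comNzRingType.
Implicit Types X Y Z V : cplx R.

Lemma diffD X (i : int) (x y : X i) : diff X i (x + y) = diff X i x + diff X i y.
Proof. exact: linearD. Qed.
Lemma diffN X (i : int) (x : X i) : diff X i (- x) = - diff X i x.
Proof. exact: linearN. Qed.
Lemma diff0 X (i : int) : diff X i 0 = 0.
Proof. exact: linear0. Qed.
Lemma cmD X Y (f : chain_map X Y) (i : int) x y : f i (x + y) = f i x + f i y.
Proof. exact: linearD. Qed.
Lemma cmN X Y (f : chain_map X Y) (i : int) x : f i (- x) = - f i x.
Proof. exact: linearN. Qed.
Lemma cm0 X Y (f : chain_map X Y) (i : int) : f i 0 = 0.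
Proof. exact: linear0. Qed.
Definition addE := (diffD, diffN, cmD, cmN).
Definition zeroE := (diff0, cm0).

(** Injectivity and surjectivity on cohomology, stated on cocycles. Degrees are
    written [i + 1] so that coboundaries need no transport. *)
Definition qis X Y (f : chain_map X Y) : Prop :=
  (forall (i : int) (x : X (i + 1)) (y : Y i),
     diff X _ x = 0 -> f _ x = diff Y i y -> exists x', x = diff X i x') /\
  (forall (i : int) (y : Y (i + 1)), diff Y _ y = 0 ->
     exists (x : X (i + 1)) (y' : Y i), diff X _ x = 0 /\ y = f _ x + diff Y i y').

Lemma addr0P (V : zmodType) (x y : V) : x + y = 0 <-> x = - y.
Proof. by split=> [/eqP|->]; [rewrite addr_eq0 => /eqP | rewrite addNr]. Qed.

(** If (x, y) is a cocycle of the cone, then [f x] bounds, hence x = d x1 bounds,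
    and y + f x1 is a cocycle, which up to a boundary comes from a cocycle x2. *)
Lemma qis_cone X Y (f : chain_map X Y) : qis f -> acyclic (cone f).
Proof.
case=> inj srj i [x y] /= [e1 e2].
have dx : diff X _ x = 0 by apply/eqP; rewrite -oppr_eq0 e1.
have [x1 ex] : exists x', x = diff X (i + 1) x'.
  by apply: (inj _ _ (- y) dx); rewrite !addE; apply/addr0P.
have [x2 [y2 [dx2 e3]]] : exists (x2 : X (i + 1)) (y2 : Y i),
    diff X _ x2 = 0 /\ f _ x1 + y = f _ x2 + diff Y i y2.
  by apply: srj; rewrite !addE -cm_diff -ex.
exists (x2 - x1, y2); pairs.
  by rewrite !addE dx2 sub0r opprK.
by rewrite !addE addrAC -e3 addrAC subrr add0r.
Qed.

Lemma qis_bij X Y (f : chain_map X Y) :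
  (forall (i : int) x, f i x = 0 -> x = 0) ->
  (forall (i : int) y, exists x, f i x = y) -> qis f.
Proof.
move=> inj srj; split=> [i x y _|i y dy].
  have [x' <-] := srj _ y; rewrite -cm_diff => e; exists x'.
  by apply/eqP; rewrite -subr_eq0; apply/eqP/inj; rewrite !addE e subrr.
have [x ex] := srj _ y; exists x, 0; rewrite ?zeroE addr0 ex; split=> //.
by apply: inj; rewrite cm_diff ex.
Qed.

Lemma acyclic_cone_id X : acyclic (cone (cm_id X)).
Proof. by apply: qis_cone; apply: qis_bij => [//|i y]; exists y. Qed.

End QuasiIso.

(** * Predicates on complexes that are stable under cones *)

Section Triangulated.
Variable R : comNzRingType.
Implicit Types X Y Z V W : cplx R.

(** What the calculus of fractions needs of the complexes that become zero. *)
Record tri_stable (N : cplx R -> Prop) : Prop := TriStable {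
  ts_acyclic : forall X, acyclic X -> N X;
  ts_qis : forall X Y (f : chain_map X Y), qis f -> N X <-> N Y;
  ts_shift : forall X, N X <-> N (cplx_shift X);
  ts_cone : forall X Y (f : chain_map X Y), N X -> N Y -> N (cone f) }.

Variables (N : cplx R -> Prop) (NP : tri_stable N).

(** The weak maps: those that are inverted when [N] is annihilated. *)
Definition wk X Y (f : chain_map X Y) : Prop := N (cone f).

Section Rotate.
Variables (X Y : cplx R) (f : chain_map X Y).

Fact rot_linear (i : int) : linear (fun u : cone (cone_in f) i => u.2.1 : cplx_shift X i).
Proof. by []. Qed.

(** Rotation: coning off [Y] in the cone of [X -> Y] leaves [X] shifted. *)
Program Definition rot_map : chain_map (cone (cone_in f)) (cplx_shift X) :=
  @ChainMap R _ _ (fun i : int => mk_linear (@rot_linear i)) _.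
Next Obligation. by move=> i [y [x z]] /=; rewrite add0r. Qed.

Lemma qis_rot : qis rot_map.
Proof.
split=> [i [y [x z]] x'|i x] /=.
  case=> _ _ ez ex; exists (z - f _ x', (x', 0)).
  pairs.
  - rewrite !addE -cm_diff; move: ez; rewrite ex !addE => ez.
    by zuse ez.
  - by rewrite ex; zmod.
  - by rewrite ?zeroE; zmod.
move=> /eqP; rewrite oppr_eq0 => /eqP dx.
exists (- f _ x, (x, 0)), 0; split.
  pairs.
  - by rewrite !addE -cm_diff dx !zeroE; zmod.
  - by rewrite dx; zmod.
  - by rewrite ?zeroE; zmod.
by rewrite ?zeroE; zmod.
Qed.

End Rotate.

Section Unrotate.
Variables (X Y : cplx R) (f : chain_map X Y).

Fact unrot_linear (i : int) :
  linear (fun y => ((0, y), 0) : cone (cone_out f) i).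
Proof. by move=> a x y; pairs; rewrite ?scaler0 ?addr0. Qed.

(** Rotation in the other direction: the cone of [cone f -> X[1]] is [Y[1]]. *)
Program Definition unrot_map : chain_map (cplx_shift Y) (cone (cone_out f)) :=
  @ChainMap R _ _ (fun i : int => mk_linear (@unrot_linear i)) _.
Next Obligation.
move=> i y; pairs.
- by rewrite ?zeroE; zmod.
- by rewrite ?zeroE; zmod.
- by rewrite ?zeroE; zmod.
Qed.

Lemma qis_unrot : qis unrot_map.
Proof.
split=> [i y [[x' y'] x0] _|i [[x y] x0]] /=.
  case=> ex ey e0; exists (f _ x0 + y').
  rewrite ey !addE -cm_diff.
  have -> : diff X _ x0 = x' by zuse e0.
  zmod.
case=> ex ey e0.
have dx : diff X _ x = 0 by apply: oppr_inj; apply: oppr_inj; rewrite ex; zmod.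
have {}e0 : x = diff X _ x0 by zuse e0.
exists (y + f _ x0), ((x0, 0), 0); split.
  rewrite !addE -cm_diff -e0; apply: oppr_inj; zuse ey.
pairs.
- by rewrite e0; zmod.
- by rewrite ?zeroE; zmod.
- by rewrite ?zeroE; zmod.
Qed.

Lemma ts_cocone : N (cone f) -> N X -> N Y.
Proof.
move=> Nf /(ts_shift NP) NX; apply/(ts_shift NP); apply/(ts_qis NP qis_unrot).
exact: ts_cone.
Qed.

End Unrotate.

Lemma wk_cone_in X Y (f : chain_map X Y) : N X -> wk (cone_in f).
Proof. by move=> NX; apply/(ts_qis NP (qis_rot f)); apply: (ts_shift NP _).1. Qed.

Lemma wk_id X : wk (cm_id X).
Proof. exact/(ts_acyclic NP)/acyclic_cone_id. Qed.

Lemma wk_qis X Y (f : chain_map X Y) : qis f -> wk f.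
Proof. by move/qis_cone/(ts_acyclic NP). Qed.

Section Compose.
Variables (X Y Z : cplx R) (t : chain_map Y Z) (s : chain_map X Y).

Fact oct_linear (i : int) :
  linear (fun u : cone t i => (0, u.1) : cplx_shift (cone s) i).
Proof. by move=> a x y; pairs; rewrite ?scaler0 ?addr0. Qed.

(** The connecting map of the octahedron on [t] and [s]; up to a shift, its cone is
    the cone of the composite. *)
Program Definition oct_map : chain_map (cone t) (cplx_shift (cone s)) :=
  @ChainMap R _ _ (fun i : int => mk_linear (@oct_linear i)) _.
Next Obligation. by move=> i [y z]; pairs; rewrite ?zeroE; zmod. Qed.

Fact oct_qis_linear (i : int) :
  linear (fun u : cplx_shift (cone (cm_comp t s)) i =>
    ((s _ u.1, u.2), (u.1, 0)) : cone oct_map i).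
Proof.
by move=> a x y; pairs; rewrite ?linearP ?scaler0 ?addr0.
Qed.

Program Definition oct_qis_map :
    chain_map (cplx_shift (cone (cm_comp t s))) (cone oct_map) :=
  @ChainMap R _ _ (fun i : int => mk_linear (@oct_qis_linear i)) _.
Next Obligation.
move=> i [x z]; pairs.
- by rewrite !addE cm_diff.
- zmod.
- zmod.
- by rewrite ?zeroE; zmod.
Qed.

Lemma qis_oct : qis oct_qis_map.
Proof.
split=> [i [x z] [[y' z'] [x' y0]] _|i [[y z] [x y0]]] /=.
  case=> esx ez ex ey; exists (x', z' + t _ y0).
  pairs; first by zuse ex.
  rewrite ez !addE -cm_diff.
  have -> : y' = s _ x' + diff Y _ y0 by zuse ey.
  by rewrite !addE; zmod.
case=> dy ez dx ey.
have {ey}ey : y = s _ x + diff Y _ y0 by zuse ey.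
exists (x, z + t _ y0), ((y0, 0), (0, 0)).
have {}dx : diff X _ x = 0 by zuse dx.
split; pairs.
- by rewrite dx; zmod.
- rewrite !addE -cm_diff; apply: (zlin ez); rewrite ey !addE; zmod.
all: by rewrite ?ey ?zeroE; zmod.
Qed.

Lemma wk_comp : wk t -> wk s -> wk (cm_comp t s).
Proof.
move=> Nt /(ts_shift NP) Ns; apply/(ts_shift NP); apply/(ts_qis NP qis_oct).
exact: ts_cone.
Qed.

End Compose.

Section Pushout.
Variables (X Y W : cplx R) (s : chain_map X Y) (f : chain_map X W).

Fact po_linear (i : int) : linear (fun x : X i => (s i x, - f i x) : cplx_dsum Y W i).
Proof. by move=> a x y; pairs; rewrite ?linearP //= opprD scalerN. Qed.

Program Definition po_span : chain_map X (cplx_dsum Y W) :=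
  @ChainMap R _ _ (fun i : int => mk_linear (@po_linear i)) _.
Next Obligation. by move=> i x; pairs; rewrite ?addE cm_diff. Qed.

(** The homotopy pushout. *)
Definition po := cone po_span.

Fact po_inl_linear (i : int) : linear (fun y => (0, (y, 0)) : po i).
Proof. by move=> a x y; pairs; rewrite ?scaler0 ?addr0. Qed.

Program Definition po_inl : chain_map Y po :=
  @ChainMap R _ _ (fun i : int => mk_linear (@po_inl_linear i)) _.
Next Obligation.
by move=> i x; pairs; rewrite ?zeroE; zmod.
Qed.

Fact po_inr_linear (i : int) : linear (fun w => (0, (0, w)) : po i).
Proof. by move=> a x y; pairs; rewrite ?scaler0 ?addr0. Qed.

Program Definition po_inr : chain_map W po :=
  @ChainMap R _ _ (fun i : int => mk_linear (@po_inr_linear i)) _.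
Next Obligation.
by move=> i x; pairs; rewrite ?zeroE; zmod.
Qed.

(** The homotopy is the inclusion of [X] as the first summand of the cone. *)
Lemma po_square : homotopic (cm_comp po_inl s) (cm_comp po_inr f).
Proof.
have lin (i : int) : linear (fun x => (x, (0, 0)) : po i).
  by move=> a x y; pairs; rewrite ?scaler0 ?addr0.
exists (fun i => mk_linear (lin i)) => i x.
by pairs; rewrite ?zeroE; zmod.
Qed.

Fact po_inr_cone_linear (i : int) :
  linear (fun u : cone po_inr i => (u.2.1, u.2.2.1) : cone s i).
Proof. by []. Qed.

(** Pushing [s] out along [f] does not change its cone. *)
Program Definition po_inr_cone : chain_map (cone po_inr) (cone s) :=
  @ChainMap R _ _ (fun i : int => mk_linear (@po_inr_cone_linear i)) _.
Next Obligation. by move=> i [w [x [y w0]]]; pairs; zmod. Qed.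

Lemma qis_po_inr : qis po_inr_cone.
Proof.
split=> [i [w [x [y w0]]] [x' y']|i [x y]] /=.
  case=> dw ex ey ew [ex' ey']; exists (w0 + f _ x', (x', (y', 0))).
  pairs.
  - rewrite !addE -cm_diff; have -> : diff X _ x' = - x by rewrite ex' opprK.
    by rewrite !addE; zuse ew.
  - by rewrite ex'; zmod.
  - by rewrite ey'; zmod.
  - by rewrite ?zeroE; zmod.
case=> ex ey.
have dx : diff X _ x = 0 by apply: oppr_inj; rewrite ex; zmod.
exists (f _ x, (x, (y, 0))), (0, 0); split.
  pairs.
  - by rewrite -cm_diff dx !zeroE; zmod.
  - by rewrite dx; zmod.
  - by zuse ey.
  - by rewrite ?zeroE; zmod.
by pairs; rewrite ?zeroE; zmod.
Qed.

Lemma wk_po_inr : wk s -> wk po_inr.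
Proof. by move=> Ns; apply/(ts_qis NP qis_po_inr). Qed.

Fact po_inl_cone_linear (i : int) :
  linear (fun u : cone po_inl i => (u.2.1, - u.2.2.2) : cone f i).
Proof. by move=> a u v; pairs=> //; rewrite opprD scalerN. Qed.

(** Symmetrically for [f]; the sign comes from the one in [po_span]. *)
Program Definition po_inl_cone : chain_map (cone po_inl) (cone f) :=
  @ChainMap R _ _ (fun i : int => mk_linear (@po_inl_cone_linear i)) _.
Next Obligation.
by move=> i [w [x [y w0]]]; pairs; rewrite ?addE; zmod.
Qed.

Lemma qis_po_inl : qis po_inl_cone.
Proof.
split=> [i [y [x [y0 w]]] [x' w']|i [x w]] /=.
  case=> dy ex ey ew [ex' ew']; exists (y0 - s _ x', (x', (0, - w'))).
  pairs.
  - rewrite !addE -cm_diff; have -> : diff X _ x' = - x by rewrite ex' opprK.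
    by rewrite !addE; zuse ey.
  - by rewrite ex'; zmod.
  - by rewrite ?zeroE; zmod.
  - by rewrite !addE -[LHS]opprK ew'; zmod.
case=> ex ew.
have dx : diff X _ x = 0 by apply: oppr_inj; rewrite ex; zmod.
exists (- s _ x, (x, (0, - w))), (0, 0); split.
  pairs.
  - by rewrite !addE -cm_diff dx !zeroE; zmod.
  - by rewrite dx; zmod.
  - by rewrite ?zeroE; zmod.
  - by rewrite !addE; apply: oppr_inj; zuse ew.
by pairs; rewrite ?zeroE; zmod.
Qed.

Lemma wk_po_inl : wk f -> wk po_inl.
Proof. by move=> Nf; apply/(ts_qis NP qis_po_inl). Qed.

End Pushout.

Section ExtendToCone.
Variables (X Y Z : cplx R) (s : chain_map X Y) (f : chain_map Y Z).
Hypothesis fs0 : homotopic (cm_comp f s) (cm_zero X Z).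

(** A null-homotopy of [f s] is the same as an extension of [f] to the cone of [s]. *)
Lemma cone_factor : exists g : chain_map (cone s) Z,
  forall (i : int) x, cm_comp g (cone_in s) i x = f i x.
Proof.
case: fs0 => h H.
have lin (i : int) : linear (fun u : cone s i => h i u.1 + f i u.2).
  by move=> a u v; rewrite /= !linearP scalerDr addrACA.
have chm (i : int) x :
    mk_linear (lin (i + 1)) (diff _ i x) = diff _ i (mk_linear (lin i) x).
  case: x => x y /=; rewrite !addE -cm_diff [h _ _]linearN.
  by move: (H i x) => /= e; zuse e.
by exists (ChainMap chm) => i x; rewrite /= linear0 add0r.
Qed.

(** Left cancellation: coning off the extension of [f] to the cone of [s] makes [f]
    null-homotopic. *)
Lemma wk_kill : wk s -> exists (V : cplx R) (t : chain_map Z V),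
  wk t /\ homotopic (cm_comp t f) (cm_zero Y V).
Proof.
move=> Ns; have [g gE] := cone_factor.
exists (cone g), (cone_in g); split; first exact: wk_cone_in.
apply: (@htp_trans _ _ _ _ (cm_comp (cm_comp (cone_in g) g) (cone_in s))).
  by apply: htp_ext => i x; rewrite /= -gE.
apply: (@htp_trans _ _ _ _ (cm_comp (cm_zero _ _) (cone_in s))).
  apply: htp_compr.
  have lin (i : int) : linear (fun x => (x, 0) : cone g i).
    by move=> a x y; pairs; rewrite ?scaler0 ?addr0.
  exists (fun i => mk_linear (lin i)) => i x.
  by pairs; rewrite ?zeroE; zmod.
exact: htp_refl.
Qed.

End ExtendToCone.

Section ShiftCone.
Variables (X Y : cplx R) (f : chain_map X Y).

Fact cone_shift_linear (i : int) :
  linear (fun u : cplx_shift (cone f) i => (- u.1, u.2) : cone (cm_shift f) i).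
Proof. by move=> a u v; pairs=> //; rewrite opprD scalerN. Qed.

(** The sign corrects that of the shifted differential. *)
Program Definition cone_shift_map : chain_map (cplx_shift (cone f)) (cone (cm_shift f)) :=
  @ChainMap R _ _ (fun i : int => mk_linear (@cone_shift_linear i)) _.
Next Obligation.
by move=> i [x y]; pairs; rewrite !addE; zmod.
Qed.

Lemma wk_shift : wk (cm_shift f) <-> wk f.
Proof.
have q : qis cone_shift_map.
  apply: qis_bij => i [x y] /=.
    by case=> ex ->; rewrite -[x]opprK ex oppr0.
  by exists (- x, y); rewrite opprK.
split=> Nf; first by apply/(ts_shift NP)/(ts_qis NP q).
by apply/(ts_qis NP q); apply: (ts_shift NP _).1.
Qed.

End ShiftCone.
End Triangulated.

(** * Relational representations and their extension to a localization *)

Section RelRep.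
Variable R : comNzRingType.

(** A functor from [C] to sets and relations, where [rrel (idm X)] plays the role
    of the equality on [car X] and need not be reflexive. With relations, the
    inverse of a bijection is its converse, so a functor that turns a class of
    morphisms into bijections extends to the formal inverses without choices;
    moreover covariant and contravariant functors are treated alike. *)
Record rrep (C : lincat R) := RRep {
  car : C -> Type;
  rrel : forall X Y : C, Defs.hom X Y -> car X -> car Y -> Prop;
  rel_heq : forall (X Y : C) (f g : Defs.hom X Y) x y,
    heq f g -> rrel f x y <-> rrel g x y;
  rel_comp : forall (X Y Z : C) (g : Defs.hom Y Z) (f : Defs.hom X Y) x z,
    rrel (compm g f) x z <-> exists y, rrel f x y /\ rrel g y z;
  rel_sym : forall (X : C) (x x' : car X), rrel (idm X) x x' -> rrel (idm X) x' x;
  rel_idl : forall (X Y : C) (f : Defs.hom X Y) x' x y,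
    rrel (idm X) x' x -> rrel f x y -> rrel f x' y;
  rel_idr : forall (X Y : C) (f : Defs.hom X Y) x y y',
    rrel f x y -> rrel (idm Y) y y' -> rrel f x y';
  rel_dom : forall (X Y : C) (f : Defs.hom X Y) x y, rrel f x y -> rrel (idm X) x x;
  rel_cod : forall (X Y : C) (f : Defs.hom X Y) x y, rrel f x y -> rrel (idm Y) y y }.

Arguments rrel {C} r {X Y} f x y.

Section Isomorphisms.
Variables (C : lincat R) (rho : rrep C).
Implicit Types X Y Z : C.

(** [rrel rho f] is a bijection modulo the equality relations. *)
Record invertible X Y (f : Defs.hom X Y) : Prop := Invertible {
  inv_totl : forall x, rrel rho (idm X) x x -> exists y, rrel rho f x y;
  inv_totr : forall y, rrel rho (idm Y) y y -> exists x, rrel rho f x y;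
  inv_funl : forall x x' y, rrel rho f x y -> rrel rho f x' y -> rrel rho (idm X) x x';
  inv_funr : forall x y y', rrel rho f x y -> rrel rho f x y' -> rrel rho (idm Y) y y' }.

Lemma is_inverse_sym X Y (f : Defs.hom X Y) (g : Defs.hom Y X) :
  is_inverse f g -> is_inverse g f.
Proof. by case. Qed.

Lemma rel_inverse X Y (f : Defs.hom X Y) (g : Defs.hom Y X) x y :
  is_inverse f g -> rrel rho f x y -> rrel rho g y x.
Proof.
move=> [gf fg] fxy.
have /(rel_heq _ _ gf)/rel_comp [y0 [fxy0 gy0x]] := rel_dom fxy.
have /(rel_heq _ _ fg) y0y : rrel rho (compm f g) y0 y.
  by apply/rel_comp; exists x.
by apply: rel_idl gy0x; apply: rel_sym.
Qed.

Lemma iso_invertible X Y (f : Defs.hom X Y) : is_iso f -> invertible f.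
Proof.
move=> [g fg]; have gf := is_inverse_sym fg.
have E x y : rrel rho f x y <-> rrel rho g y x by split; apply: rel_inverse.
case: (fg) => e1 e2; split.
- by move=> x /(rel_heq _ _ e1)/rel_comp [y [fxy _]]; exists y.
- by move=> y /(rel_heq _ _ e2)/rel_comp [x [/E fxy _]]; exists x.
- by move=> x x' y fxy /E gyx'; apply/(rel_heq _ _ e1)/rel_comp; exists y.
- by move=> x y y' /E gyx fxy'; apply/(rel_heq _ _ e2)/rel_comp; exists x.
Qed.

Lemma rel_conj X Y X' Y' (s : Defs.hom X Y) (u : Defs.hom X' Y')
    (a : Defs.hom X X') (b : Defs.hom Y Y') x y :
  is_iso b -> heq (compm b s) (compm u a) ->
  rrel rho s x y <-> exists x' y', [/\ rrel rho a x x', rrel rho u x' y' & rrel rho b y y'].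
Proof.
move=> /iso_invertible Ib e; split.
  move=> sxy; have [y' byy'] := inv_totl Ib (rel_cod sxy).
  have : rrel rho (compm b s) x y' by apply/rel_comp; exists y.
  by move/(rel_heq _ _ e)/rel_comp => [x' [axx' ux'y']]; exists x', y'.
move=> [x' [y' [axx' ux'y' byy']]].
have : rrel rho (compm u a) x y' by apply/rel_comp; exists x'.
move/(rel_heq _ _ e)/rel_comp => [y1 [sxy1 by1y']].
by apply: rel_idr sxy1 _; apply: inv_funl Ib _ _ _ by1y' byy'.
Qed.

Lemma invertible_conj X Y X' Y' (s : Defs.hom X Y) (u : Defs.hom X' Y')
    (a : Defs.hom X X') (b : Defs.hom Y Y') :
  is_iso a -> is_iso b -> heq (compm b s) (compm u a) ->
  invertible u -> invertible s.
Proof.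
move=> Ia Ib e Iu; have E x y := rel_conj x y Ib e.
move/iso_invertible: Ia => Ia; move/iso_invertible: Ib => Ib; split.
- move=> x /(inv_totl Ia) [x' axx'].
  have [y' ux'y'] := inv_totl Iu (rel_cod axx').
  have [y byy'] := inv_totr Ib (rel_cod ux'y').
  by exists y; apply/E; exists x', y'.
- move=> y /(inv_totl Ib) [y' byy'].
  have [x' ux'y'] := inv_totr Iu (rel_cod byy').
  have [x axx'] := inv_totr Ia (rel_dom ux'y').
  by exists x; apply/E; exists x', y'.
- move=> x1 x2 y /E [x1' [y1' [a1 u1 b1]]] /E [x2' [y2' [a2 u2 b2]]].
  have y12 := inv_funr Ib b1 b2.
  have x12 := inv_funl Iu (rel_idr u1 y12) u2.
  exact: inv_funl Ia _ _ _ (rel_idr a1 x12) a2.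
- move=> x y1 y2 /E [x1' [y1' [a1 u1 b1]]] /E [x2' [y2' [a2 u2 b2]]].
  have x12 := inv_funr Ia a1 a2.
  have y12 := inv_funr Iu u1 (rel_idl x12 u2).
  exact: inv_funl Ib _ _ _ (rel_idr b1 y12) b2.
Qed.

Variables (null : forall X : C, car rho X -> Prop).
Variable scale : R -> forall X : C, car rho X -> car rho X.

(** A contravariant functor to pointed sets with an action of [R]: elements can be
    pulled back, and pulling back respects the null elements and the scalars. *)
Record presheaf : Prop := Presheaf {
  psh_null : forall X Y (f : Defs.hom X Y) x y, rrel rho f x y -> null y -> null x;
  psh_scale : forall r X Y (f : Defs.hom X Y) x y,
    rrel rho f x y -> rrel rho f (scale r x) (scale r y);
  psh_tot : forall X Y (f : Defs.hom X Y) y, rrel rho (idm Y) y y -> exists x, rrel rho f x y;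
  psh_scaleM : forall r s X (x : car rho X), null (scale s (scale r x)) -> null (scale (s * r) x) }.

Hypothesis psh : presheaf.

Definition null_reflecting X Y (f : Defs.hom X Y) : Prop :=
  forall x y, rrel rho f x y -> null x -> null y.

Lemma iso_null_reflecting X Y (f : Defs.hom X Y) : is_iso f -> null_reflecting f.
Proof. by move=> [g fg] x y /(rel_inverse fg)/(psh_null psh). Qed.

Lemma null_reflecting_conj X Y X' Y' (s : Defs.hom X Y) (u : Defs.hom X' Y')
    (a : Defs.hom X X') (b : Defs.hom Y Y') :
  is_iso a -> is_iso b -> heq (compm b s) (compm u a) ->
  null_reflecting u -> null_reflecting s.
Proof.
move=> Ia Ib e Nu x y /(rel_conj x y Ib e) [x' [y' [axx' ux'y' byy']]].
by move=> /(iso_null_reflecting Ia axx')/(Nu _ _ ux'y')/(psh_null psh byy').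
Qed.

Definition kills (r : R) X : Prop :=
  forall x : car rho X, rrel rho (idm X) x x -> null (scale r x).

Lemma kills_iso r X Y : isomorphic X Y -> kills r X -> kills r Y.
Proof.
move=> [f If] kX y /(psh_tot psh f) [x fxy].
apply: (iso_null_reflecting If (psh_scale psh r fxy)).
by apply: kX; apply: rel_dom fxy.
Qed.

(** Exactness of car Z -> car Y -> car X in the middle. *)
Definition exact_at X Y Z (f : Defs.hom X Y) (g : Defs.hom Y Z) : Prop :=
  forall x y, rrel rho f x y -> null x -> exists z, rrel rho g y z.

Lemma exact_at_iso X Y Z (f : Defs.hom X Y) (g : Defs.hom Y Z) h
    X' Y' Z' (f' : Defs.hom X' Y') (g' : Defs.hom Y' Z') h' :
  tri_iso f g h f' g' h' -> exact_at f g -> exact_at f' g'.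
Proof.
move=> [a [b [c [[Ia /iso_invertible Ib /iso_invertible Ic] [eab ebc _]]]]] ex.
move=> x' y' fxy' nx'; have [x axx'] := psh_tot psh a (rel_dom fxy').
have nx := psh_null psh axx' nx'.
have : rrel rho (compm f' a) x y' by apply/rel_comp; exists x'.
move/(rel_heq _ _ eab)/rel_comp => [y1 [fxy1 by1y']].
have [z gy1z] := ex _ _ fxy1 nx.
have [z' czz'] := inv_totl Ic (rel_cod gy1z).
have : rrel rho (compm c g) y1 z' by apply/rel_comp; exists z.
move/(rel_heq _ _ ebc)/rel_comp => [y2 [by1y2 gy2z']].
by exists z'; apply: rel_idl gy2z'; apply: inv_funr Ib _ _ _ by1y' by1y2.
Qed.

(** For y in [car Y], the pullback of [r y] to [X] is null, so [r y] comes from [Z],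
    where [s] makes it null. *)
Lemma kills_extension r s X Y Z (f : Defs.hom X Y) (g : Defs.hom Y Z) :
  exact_at f g -> kills r X -> kills s Z -> kills (s * r) Y.
Proof.
move=> ex kX kZ y y1; apply: (psh_scaleM psh).
have [x fxy] := psh_tot psh f y1.
have [z gyz] := ex _ _ (psh_scale psh r fxy) (kX _ (rel_dom fxy)).
by apply: psh_null psh _ _ _ _ _ (psh_scale psh s gyz) _; apply: kZ; apply: rel_cod gyz.
Qed.

End Isomorphisms.

Section Localization.
Variables (T : tricat R) (N : T -> Prop) (rho : rrep T).
Hypothesis inv : forall (X Y : T) (s : Defs.hom X Y), has_cone_in N s -> invertible rho s.

(** A formal inverse acts by the converse relation. *)
Fixpoint loc_rel X Y (p : loc_hom N X Y) : car rho X -> car rho Y -> Prop :=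
  match p in loc_hom _ X Y return car rho X -> car rho Y -> Prop with
  | loc_in _ _ f => fun x y => rrel rho f x y
  | loc_inv _ _ s _ => fun y x => rrel rho s x y
  | loc_comp _ _ _ p q => fun x z => exists y, loc_rel q x y /\ loc_rel p y z
  end.

Lemma loc_rel_dom X Y (p : loc_hom N X Y) x y : loc_rel p x y -> rrel rho (idm X) x x.
Proof.
elim: p x y => {X Y} [X Y f|X Y s w|X Y Z p IHp q IHq] x y /=.
- exact: rel_dom.
- exact: rel_cod.
- by case=> z [/IHq].
Qed.

Lemma loc_rel_cod X Y (p : loc_hom N X Y) x y : loc_rel p x y -> rrel rho (idm Y) y y.
Proof.
elim: p x y => {X Y} [X Y f|X Y s w|X Y Z p IHp q IHq] x y /=.
- exact: rel_cod.
- exact: rel_dom.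
- by case=> z [_ /IHp].
Qed.

Lemma loc_rel_idl X Y (p : loc_hom N X Y) x' x y :
  rrel rho (idm X) x' x -> loc_rel p x y -> loc_rel p x' y.
Proof.
elim: p x' x y => {X Y} [X Y f|X Y s w|X Y Z p IHp q IHq] x' x y xx' /=.
- exact: rel_idl.
- by move/rel_idr; apply; apply: rel_sym.
- by case=> z [/(IHq _ _ _ xx') ? ?]; exists z.
Qed.

Lemma loc_rel_idr X Y (p : loc_hom N X Y) x y y' :
  loc_rel p x y -> rrel rho (idm Y) y y' -> loc_rel p x y'.
Proof.
elim: p x y y' => {X Y} [X Y f|X Y s w|X Y Z p IHp q IHq] x y y' /=.
- exact: rel_idr.
- by move=> sxy yy'; apply: rel_idl (rel_sym yy') sxy.
- by case=> z [? /IHp pzy] /pzy ?; exists z.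
Qed.

(** The two inverse laws are where bijectivity of the inverted morphisms is used. *)
Lemma loc_rel_eq X Y (p q : loc_hom N X Y) : loc_eq p q ->
  forall x y, loc_rel p x y <-> loc_rel q x y.
Proof.
elim=> {X Y p q} //.
- by move=> X Y p q _ E x y; rewrite E.
- by move=> X Y p q r _ E1 _ E2 x y; rewrite E1.
- move=> X Y Z p p' q q' _ Ep _ Eq x y /=.
  by split=> -[z [/Eq ? /Ep ?]]; exists z.
- move=> X Y Z V p q r x y /=; split.
    by move=> [z [[z' [? ?]] ?]]; exists z'; split=> //; exists z.
  by move=> [z [? [z' [? ?]]]]; exists z'; split=> //; exists z.
- move=> X Y p x y /=; split=> [[y' [pxy' /(loc_rel_idr pxy')//]]|pxy].
  by exists y; split=> //; apply: loc_rel_cod pxy.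
- move=> X Y p x y /=; split=> [[x' [/loc_rel_idl E /E//]]|pxy].
  by exists x; split=> //; apply: loc_rel_dom pxy.
- by move=> X Y f g fg x y; apply: rel_heq.
- by move=> X Y Z g f x y; apply: rel_comp.
- move=> X Y s w x x'; have Is := inv w; split=> /= [[y [sxy sx'y]]|xx'].
    exact: inv_funl Is _ _ _ sxy sx'y.
  have [y sxy] := inv_totl Is (rel_dom xx'); exists y; split=> //.
  by apply: rel_idl sxy; apply: rel_sym.
- move=> X Y s w y y'; have Is := inv w; split=> /= [[x [sxy sxy']]|yy'].
    exact: inv_funr Is _ _ _ sxy sxy'.
  have [x sxy] := inv_totr Is (rel_dom yy'); exists x; split=> //.
  by apply: rel_idr sxy yy'.
Qed.

Definition loc_rrep : rrep (verdier N).
Proof.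
apply: (@RRep (verdier N) (car rho) loc_rel).
- by move=> X Y f g x y fg; apply: loc_rel_eq.
- by [].
- by move=> X x x'; apply: (@rel_sym _ rho).
- exact: loc_rel_idl.
- exact: loc_rel_idr.
- exact: loc_rel_dom.
- exact: loc_rel_cod.
Defined.

Variables (null : forall X : T, car rho X -> Prop).
Variable scale : R -> forall X : T, car rho X -> car rho X.
Hypothesis psh : presheaf null scale.
Hypothesis refl : forall (X Y : T) (s : Defs.hom X Y),
  has_cone_in N s -> null_reflecting null s.

Lemma loc_presheaf : @presheaf (verdier N) loc_rrep null scale.
Proof.
split=> /=.
- move=> X Y p; elim: p => {X Y} [X Y f|X Y s w|X Y Z p IHp q IHq] x y /=.
  + exact: psh_null psh _ _ _ _ _.
  + exact: refl.
  + by move=> [z [qxz pzy]] /(IHp _ _ pzy)/(IHq _ _ qxz).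
- move=> r X Y p; elim: p => {X Y} [X Y f|X Y s w|X Y Z p IHp q IHq] x y /=.
  + exact: (psh_scale psh).
  + exact: (psh_scale psh).
  + by move=> [z [/IHq ? /IHp ?]]; exists (scale r z).
- move=> X Y p; elim: p => {X Y} [X Y f|X Y s w|X Y Z p IHp q IHq] y yy /=.
  + exact: psh_tot psh _ _ _ _ _.
  + exact: inv_totl (inv w) _ _.
  + have [z pzy] := IHp _ yy; have [x qxz] := IHq _ (loc_rel_dom pzy).
    by exists x, z.
- exact: psh_scaleM psh.
Qed.

(** Exactness passes to the quotient because the exact triangles there are, up to
    isomorphism, images of exact triangles. *)
Lemma loc_exact_at :
  (forall (X Y Z : T) (f : Defs.hom X Y) (g : Defs.hom Y Z) h,
     exact_tri f g h -> exact_at null f g) ->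
  forall (X Y Z : verdier N) (f : Defs.hom X Y) (g : Defs.hom Y Z) h,
    exact_tri f g h -> @exact_at (verdier N) loc_rrep null _ _ _ f g.
Proof.
move=> ex X Y Z p q r [X' [Y' [Z' [f [g [h [fgh iso]]]]]]].
apply: (exact_at_iso loc_presheaf iso); exact: ex fgh.
Qed.

End Localization.

Section Restriction.
Variables (T : tricat R) (P : T -> Prop).
Hypothesis P_dsum : forall X Y, P X -> P Y -> P (dsum X Y).
Hypothesis P_shift : forall X, P X -> P (shift X).
Variable rho : rrep T.
Let F := full_sub P_dsum P_shift.

Definition full_rrep : rrep F.
Proof.
apply: (@RRep F (fun X => car rho (sval X)) (fun X Y f => @rrel _ rho _ _ f)) => /=.
- by move=> X Y f g x y; apply: rel_heq.
- by move=> X Y Z g f x z; apply: rel_comp.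
- by move=> X x x'; apply: rel_sym.
- by move=> X Y f x' x y; apply: rel_idl.
- by move=> X Y f x y y'; apply: rel_idr.
- by move=> X Y f x y; apply: rel_dom.
- by move=> X Y f x y; apply: rel_cod.
Defined.

Variables (null : forall X : T, car rho X -> Prop).
Variable scale : R -> forall X : T, car rho X -> car rho X.
Hypothesis psh : presheaf null scale.

Lemma full_presheaf :
  @presheaf F full_rrep (fun X => @null (sval X)) (fun r X => @scale r (sval X)).
Proof.
split=> /=.
- by move=> X Y f x y; apply: psh_null psh _ _ _ _ _.
- by move=> r X Y f x y; apply: (psh_scale psh).
- by move=> X Y f y; apply: psh_tot psh _ _ _ _.
- by move=> r s X x; apply: psh_scaleM psh _ _ _ _.
Qed.

End Restriction.
End RelRep.

Arguments rrel {R C} r {X Y} f x y.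

(** * Direct sums of complexes *)

Section Biproduct.
Variables (R : comNzRingType) (X Y : cplx R).

Fact dsum_inl_linear (i : int) : linear (fun x => (x, 0) : cplx_dsum X Y i).
Proof. by move=> a x y; pairs; rewrite ?scaler0 ?addr0. Qed.

Program Definition dsum_inl : chain_map X (cplx_dsum X Y) :=
  @ChainMap R _ _ (fun i : int => mk_linear (@dsum_inl_linear i)) _.
Next Obligation. by move=> i x; pairs; rewrite ?diff0. Qed.

Fact dsum_inr_linear (i : int) : linear (fun y => (0, y) : cplx_dsum X Y i).
Proof. by move=> a x y; pairs; rewrite ?scaler0 ?addr0. Qed.

Program Definition dsum_inr : chain_map Y (cplx_dsum X Y) :=
  @ChainMap R _ _ (fun i : int => mk_linear (@dsum_inr_linear i)) _.
Next Obligation. by move=> i x; pairs; rewrite ?diff0. Qed.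

Fact dsum_fst_linear (i : int) : linear (fun u : cplx_dsum X Y i => u.1).
Proof. by []. Qed.

Program Definition dsum_fst : chain_map (cplx_dsum X Y) X :=
  @ChainMap R _ _ (fun i : int => mk_linear (@dsum_fst_linear i)) _.
Next Obligation. by []. Qed.

End Biproduct.

(** * Left fractions *)

Section Fractions.
Variables (R : comNzRingType) (N : cplx R -> Prop) (NP : tri_stable N).
Implicit Types X Y Z V W : cplx R.
Let K := homotopy_category R.

Lemma htp_compZ X Y Z (r : R) (g : chain_map Y Z) (f : chain_map X Y) :
  homotopic (cm_comp g (cm_scale r f)) (cm_scale r (cm_comp g f)).
Proof. by apply: htp_ext => i x; rewrite /= linearZ. Qed.

(** A morphism out of [X] in the localization at the weak maps is a fraction
    X -> V <- W. Only its numerator is recorded: this is enough to detect zero, and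
    all the targets W are treated at once. *)
Definition frac X := {V : cplx R & chain_map X V}.

Definition frac_eq X (x x' : frac X) : Prop :=
  exists W (a : chain_map (tag x) W) (b : chain_map (tag x') W),
    [/\ wk N a, wk N b & homotopic (cm_comp a (tagged x)) (cm_comp b (tagged x'))].

Definition frac_pull X Y (f : chain_map X Y) (y : frac Y) : frac X :=
  Tagged (fun V => chain_map X V) (cm_comp (tagged y) f).

Lemma frac_eq_htp X V (u v : chain_map X V) :
  homotopic u v -> frac_eq (Tagged (fun V => chain_map X V) u) (Tagged (fun V => chain_map X V) v).
Proof.
move=> uv; exists V, (cm_id V), (cm_id V).
by split; [exact: wk_id | exact: wk_id | exact: htp_compl].
Qed.

Lemma frac_eq_refl X (x : frac X) : frac_eq x x.
Proof. by case: x => V u; apply: frac_eq_htp. Qed.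

Lemma frac_eq_sym X (x x' : frac X) : frac_eq x x' -> frac_eq x' x.
Proof. by move=> [W [a [b [Na Nb /htp_sym]]]]; exists W, b, a. Qed.

(** Two weak maps with the same source are dominated by their homotopy pushout. *)
Lemma frac_eq_trans X (x y z : frac X) : frac_eq x y -> frac_eq y z -> frac_eq x z.
Proof.
move=> [W [a [b [Na Nb e1]]]] [W' [a' [b' [Na' Nb' e2]]]].
exists (po b a'), (cm_comp (po_inl b a') a), (cm_comp (po_inr b a') b').
split; first exact/(wk_comp NP)/Na/(wk_po_inl NP).
  exact/(wk_comp NP)/Nb'/(wk_po_inr NP).
apply: (htp_trans (g := cm_comp (po_inl b a') (cm_comp b (tagged y)))).
  exact: (htp_compl (po_inl b a') e1).
apply: (htp_trans (g := cm_comp (cm_comp (po_inr b a') a') (tagged y))).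
  exact: (htp_compr (tagged y) (po_square b a')).
exact: (htp_compl (po_inr b a') e2).
Qed.

Lemma frac_pull_eq X Y (f : chain_map X Y) (y y' : frac Y) :
  frac_eq y y' -> frac_eq (frac_pull f y) (frac_pull f y').
Proof.
move=> [W [a [b [Na Nb e]]]]; exists W, a, b; split=> //.
exact: (htp_compr f e).
Qed.

Lemma frac_pull_htp X Y (f g : chain_map X Y) (y : frac Y) :
  homotopic f g -> frac_eq (frac_pull f y) (frac_pull g y).
Proof. by move=> fg; apply/frac_eq_htp/htp_compl. Qed.

Lemma frac_pull_id X (x : frac X) : frac_eq (frac_pull (cm_id X) x) x.
Proof. by case: x => V u; apply/frac_eq_htp/htp_ext. Qed.

Definition frac_rel X Y (f : chain_map X Y) (x : frac X) (y : frac Y) : Prop :=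
  frac_eq x (frac_pull f y).

Lemma frac_rel_id X (x x' : frac X) : frac_rel (cm_id X) x x' <-> frac_eq x x'.
Proof.
split=> e; apply: frac_eq_trans e _; first exact: frac_pull_id.
exact/frac_eq_sym/frac_pull_id.
Qed.

Definition frac_rrep : rrep K.
Proof.
apply: (@RRep R K frac frac_rel) => /=.
- move=> X Y f g x y fg; split=> e; apply: frac_eq_trans e _; apply: frac_pull_htp => //.
  exact: htp_sym.
- move=> X Y Z g f x z; split=> [e|[y [e1 e2]]].
    by exists (frac_pull g z); split; [exact: e | exact: frac_eq_refl].
  exact: frac_eq_trans e1 (frac_pull_eq f e2).
- by move=> X x x' /frac_rel_id/frac_eq_sym/frac_rel_id.
- by move=> X Y f x' x y /frac_rel_id; apply: frac_eq_trans.
- move=> X Y f x y y' e /frac_rel_id e'.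
  exact: frac_eq_trans e (frac_pull_eq f e').
- by move=> *; apply/frac_rel_id/frac_eq_refl.
- by move=> *; apply/frac_rel_id/frac_eq_refl.
Defined.

Definition frac_null X (x : frac X) : Prop :=
  exists W (a : chain_map (tag x) W),
    wk N a /\ homotopic (cm_comp a (tagged x)) (cm_zero X W).

Definition frac_scale (r : R) X (x : frac X) : frac X :=
  Tagged (fun V => chain_map X V) (cm_scale r (tagged x)).

Lemma frac_null_eq X (x y : frac X) : frac_eq x y -> frac_null y -> frac_null x.
Proof.
move=> [W [a [b [Na Nb e]]]] [W' [c [Nc c0]]].
exists (po b c), (cm_comp (po_inl b c) a).
split; first exact/(wk_comp NP)/Na/(wk_po_inl NP).
apply: (htp_trans (g := cm_comp (po_inl b c) (cm_comp b (tagged y)))).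
  exact: (htp_compl (po_inl b c) e).
apply: (htp_trans (g := cm_comp (cm_comp (po_inr b c) c) (tagged y))).
  exact: (htp_compr (tagged y) (po_square b c)).
apply: (htp_trans (g := cm_comp (po_inr b c) (cm_zero X W'))).
  exact: (htp_compl (po_inr b c) c0).
by apply: htp_ext => i x0; apply: cm0.
Qed.

Lemma frac_presheaf : @presheaf R K frac_rrep frac_null frac_scale.
Proof.
split=> /=.
- move=> X Y f x y e [W [a [Na a0]]]; apply: (frac_null_eq e).
  exists W, a; split=> //.
  apply: (htp_trans (g := cm_comp (cm_zero Y W) f)) (htp_compr f a0) _.
  exact: htp_ext.
- move=> r X Y f x y [W [a [b [Na Nb e]]]]; exists W, a, b; split=> //.
  apply: (htp_trans (g := cm_scale r (cm_comp a (tagged x)))).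
    by apply: htp_ext => i v; rewrite /= linearZ.
  apply: htp_trans (htp_scale r e) _.
  by apply: htp_ext => i v; rewrite /= linearZ.
- by move=> X Y f y _; exists (frac_pull f y); apply: frac_eq_refl.
- move=> r s X x; apply: frac_null_eq; apply: frac_eq_htp.
  by apply: htp_ext => i v; rewrite /= scalerA.
Qed.

(** A fraction on [X] extends along [s] to the homotopy pushout. *)
Lemma frac_wk_epi X Y (s : chain_map X Y) (x : frac X) : wk N s ->
  exists y, frac_rel s x y.
Proof.
move=> Ns; case: x => V u; exists (Tagged (fun V => chain_map Y V) (po_inl s u)).
exists (po s u), (po_inr s u), (cm_id _).
split; [exact: wk_po_inr | exact: wk_id |].
exact: htp_trans (htp_sym (po_square s u)) (htp_ext _).
Qed.

(** The difference of two extensions vanishes on the source of [s], so a weak map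
    kills it. *)
Lemma frac_wk_mono X Y (s : chain_map X Y) (y y' : frac Y) : wk N s ->
  frac_eq (frac_pull s y) (frac_pull s y') -> frac_eq y y'.
Proof.
move=> Ns [W [a [b [Na Nb e]]]].
pose d := cm_sub (cm_comp a (tagged y)) (cm_comp b (tagged y')).
have ds0 : homotopic (cm_comp d s) (cm_zero X W).
  by move/htp_sub0: e; apply: htp_trans; apply: htp_ext.
have [V [t [Nt td0]]] := wk_kill NP ds0 Ns.
exists V, (cm_comp t a), (cm_comp t b).
split; [exact: wk_comp | exact: wk_comp |].
apply/htp_sub0; apply: htp_trans td0; apply: htp_ext => i x.
by rewrite /= linearB.
Qed.

Lemma frac_wk_null X Y (s : chain_map X Y) (y : frac Y) : wk N s ->
  frac_null (frac_pull s y) -> frac_null y.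
Proof.
move=> Ns [W [a [Na e]]]; have [V [t [Nt td0]]] := wk_kill NP (f := cm_comp a (tagged y)) e Ns.
by exists V, (cm_comp t a); split; first exact: wk_comp.
Qed.

Lemma frac_invertible X Y (s : chain_map X Y) : wk N s ->
  @invertible R K frac_rrep X Y s.
Proof.
move=> Ns; split=> /=.
- by move=> x _; apply: frac_wk_epi.
- by move=> y _; exists (frac_pull s y); apply: frac_eq_refl.
- move=> x x' y e1 e2; apply/frac_rel_id.
  exact: frac_eq_trans e1 (frac_eq_sym e2).
- move=> x y y' e1 e2; apply/frac_rel_id; apply: (frac_wk_mono Ns).
  exact: frac_eq_trans (frac_eq_sym e1) e2.
Qed.

Lemma frac_null_reflecting X Y (s : chain_map X Y) : wk N s ->
  @null_reflecting R K frac_rrep frac_null X Y s.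
Proof.
move=> Ns x y /= e nx; apply: (frac_wk_null Ns); apply: frac_null_eq nx.
exact: frac_eq_sym.
Qed.

(** If the restriction of a fraction to [X] is null, a weak map makes it
    null-homotopic, and the fraction then extends to the cone. *)
Lemma frac_exact_cone X Y (f : chain_map X Y) :
  @exact_at R K frac_rrep frac_null X Y (cone f) f (cone_in f).
Proof.
move=> x y /= e nx.
have [W [a [Na af0]]] := frac_null_eq (frac_eq_sym e) nx.
have [g gE] := cone_factor (f := cm_comp a (tagged y)) af0.
exists (Tagged (fun V => chain_map (cone f) V) g), W, a, (cm_id W).
split=> //; first exact: wk_id.
by apply: htp_ext => i v; apply/esym/gE.
Qed.

Lemma frac_exact (X Y Z : K) (f : Defs.hom X Y) (g : Defs.hom Y Z) h :
  exact_tri f g h -> @exact_at R K frac_rrep frac_null X Y Z f g.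
Proof.
move=> [X' [Y' [u iso]]]; apply: (exact_at_iso frac_presheaf iso).
exact: frac_exact_cone.
Qed.

Definition cplx_kills r X := @kills R K frac_rrep frac_null frac_scale r X.

(** The universal case is the fraction given by the identity of [X]; every other one
    is a pushout of it. *)
Lemma cplx_killsP r X :
  cplx_kills r X <->
  exists W (a : chain_map X W), wk N a /\ homotopic (cm_scale r a) (cm_zero X W).
Proof.
split=> [kX|[W [a [Na a0]]] [V u] _].
  have [|W [a [Na a0]]] := kX (Tagged (fun V => chain_map X V) (cm_id X)).
    exact/frac_rel_id/frac_eq_refl.
  exists W, a; split=> //; apply: htp_trans a0.
  by apply: htp_ext => i x; rewrite /= linearZ.
exists (po a u), (po_inr a u); split; first exact: wk_po_inr.
apply: (htp_trans (g := cm_scale r (cm_comp (po_inr a u) u))); first exact: htp_compZ.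
apply: (htp_trans (g := cm_scale r (cm_comp (po_inl a u) a))).
  exact/htp_scale/htp_sym/po_square.
apply: (htp_trans (g := cm_comp (po_inl a u) (cm_scale r a))).
  exact/htp_sym/htp_compZ.
apply: htp_trans (htp_compl _ a0) _.
by apply: htp_ext => i x; apply: cm0.
Qed.

(** Sharper than passing through a triangle: nothing is asked of the cone of [f]. *)
Lemma cplx_kills_factor r s X U (f : chain_map X U) (g : chain_map U X) :
  homotopic (cm_comp g f) (cm_scale r (cm_id X)) ->
  cplx_kills s U -> cplx_kills (s * r) X.
Proof.
move=> gf kU [V u] _.
have [|W [a [Na a0]]] := kU (Tagged (fun V => chain_map U V) (cm_comp u g)).
  exact/frac_rel_id/frac_eq_refl.
exists W, a; split=> //.
apply: (htp_trans (g := cm_scale s (cm_comp (cm_comp a u) (cm_scale r (cm_id X))))).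
  by apply: htp_ext => i x; rewrite /= !linearZ /= scalerA mulrC.
apply: (htp_trans (g := cm_scale s (cm_comp (cm_comp a u) (cm_comp g f)))).
  exact/htp_scale/htp_compl/htp_sym.
apply: (htp_trans (g := cm_comp (cm_comp a (cm_scale s (cm_comp u g))) f)).
  by apply: htp_ext => i x; rewrite /= !linearZ.
apply: htp_trans (htp_compr _ a0) _.
exact: htp_ext.
Qed.

Lemma cplx_kills_wk r X Y (s : chain_map X Y) : wk N s ->
  cplx_kills r X <-> cplx_kills r Y.
Proof.
move=> Ns; split=> [kX y yy|kY x xx].
  apply: (frac_null_reflecting Ns (psh_scale frac_presheaf r (frac_eq_refl (frac_pull s y)))).
  exact/kX/frac_rel_id/frac_eq_refl.
have [y sxy] := frac_wk_epi x Ns.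
apply: (psh_null frac_presheaf (psh_scale frac_presheaf r sxy)).
exact/kY/frac_rel_id/frac_eq_refl.
Qed.

(** The scalar does not get worse here, contrary to a general extension: first make
    the restriction to [X] null, then the one to [Y]. *)
Lemma cplx_kills_dsum r X Y :
  cplx_kills r X -> cplx_kills r Y -> cplx_kills r (cplx_dsum X Y).
Proof.
move=> kX kY [V u] _.
have [|W [a [Na [h ha]]]] := kX (Tagged (fun V => chain_map X V) (cm_comp u (dsum_inl X Y))).
  exact/frac_rel_id/frac_eq_refl.
have [|W' [b [Nb [k kb]]]]
  := kY (Tagged (fun V => chain_map Y V) (cm_comp (cm_comp a u) (dsum_inr X Y))).
  exact/frac_rel_id/frac_eq_refl.
exists W', (cm_comp b a); split; first exact: wk_comp.
have lin (i : int) : linear (fun z : cplx_dsum X Y (i + 1) => b i (h i z.1) + k i z.2).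
  by move=> c x y; rewrite /= !linearP scalerDr addrACA.
exists (fun i => mk_linear (lin i)) => i [x y] /=.
have e1 := congr1 (b (i + 1)) (ha i x); have e2 := kb i y.
rewrite /= !subr0 !linearZ /= in e1 e2 *.
rewrite cmD cm_diff in e1.
have -> : u (i + 1) (x, y) = u (i + 1) (x, 0) + u (i + 1) (0, y).
  by rewrite -linearD; congr (u _ _); apply: pair_ext; rewrite /= ?addr0 ?add0r.
rewrite !cmD scalerDr e1 e2 diffD.
zmod.
Qed.

Lemma cplx_kills_dsuml r X Y : cplx_kills r (cplx_dsum X Y) -> cplx_kills r X.
Proof.
rewrite -[X in _ -> cplx_kills X _]mulr1.
apply: (cplx_kills_factor (f := dsum_inl X Y) (g := dsum_fst X Y)).
by apply: htp_ext => i x; rewrite /= scale1r.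
Qed.

Lemma frac_zero_null X Y (x : frac X) (y : frac Y) :
  frac_rel (cm_zero X Y) x y -> frac_null x.
Proof.
move=> e; apply: frac_null_eq e _; exists (tag y), (cm_id _); split; first exact: wk_id.
by apply: htp_ext => i v; rewrite /= linear0.
Qed.

Lemma cplx_kills_shift r X : cplx_kills r X -> cplx_kills r (cplx_shift X).
Proof.
move=> /cplx_killsP [W [a [Na a0]]]; apply/cplx_killsP.
exists (cplx_shift W), (cm_shift a); split; first exact/(wk_shift NP).
by apply: htp_trans (htp_shift a0) _; apply: htp_ext.
Qed.

(** If [X] is in [N], then the inclusion of V into the cone of u : X -> V is weak,
    and it makes u null-homotopic. *)
Lemma cplx_kills_mem r X : N X -> cplx_kills r X.
Proof.
move=> NX [V u] _; exists (cone u), (cone_in u); split; first exact: wk_cone_in.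
apply: (htp_trans (g := cm_scale r (cm_comp (cone_in u) u))); first exact: htp_compZ.
have lin (i : int) : linear (fun x => (x, 0) : cone u i).
  by move=> a x y; apply: pair_ext; rewrite /= ?scaler0 ?addr0.
apply: htp_trans (htp_scale r (g := cm_zero _ _) _) _.
  exists (fun i => mk_linear (lin i)) => i x.
  by apply: pair_ext; rewrite /= ?diff0; zmod.
by apply: htp_ext => i x; rewrite /= scaler0.
Qed.

End Fractions.

(** * Category laws, isomorphisms and conjugation *)

Section Laws.
Variable R : comNzRingType.

(** The category and shift laws, which a [lincat] does not contain. *)
Record cat_laws (C : lincat R) : Prop := CatLaws {
  cl_refl : forall (X Y : C) (f : Defs.hom X Y), heq f f;
  cl_sym : forall (X Y : C) (f g : Defs.hom X Y), heq f g -> heq g f;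
  cl_trans : forall (X Y : C) (f g h : Defs.hom X Y), heq f g -> heq g h -> heq f h;
  cl_comp : forall (X Y Z : C) (g g' : Defs.hom Y Z) (f f' : Defs.hom X Y),
    heq g g' -> heq f f' -> heq (compm g f) (compm g' f');
  cl_assoc : forall (X Y Z V : C) (h : Defs.hom Z V) (g : Defs.hom Y Z) (f : Defs.hom X Y),
    heq (compm h (compm g f)) (compm (compm h g) f);
  cl_idl : forall (X Y : C) (f : Defs.hom X Y), heq (compm (idm Y) f) f;
  cl_idr : forall (X Y : C) (f : Defs.hom X Y), heq (compm f (idm X)) f;
  cl_shift : forall (X Y : C) (f g : Defs.hom X Y), heq f g -> heq (shiftm f) (shiftm g);
  cl_shift_comp : forall (X Y Z : C) (g : Defs.hom Y Z) (f : Defs.hom X Y),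
    heq (shiftm (compm g f)) (compm (shiftm g) (shiftm f));
  cl_shift_id : forall X : C, heq (shiftm (idm X)) (idm (shift X)) }.

Lemma homotopy_laws : cat_laws (homotopy_category R).
Proof.
split=> /=.
- by move=> *; apply: htp_refl.
- by move=> *; apply: htp_sym.
- by move=> X Y f g h; apply: htp_trans.
- by move=> *; apply: htp_comp.
- by move=> *; apply: htp_ext.
- by move=> *; apply: htp_ext.
- by move=> *; apply: htp_ext.
- by move=> *; apply: htp_shift.
- by move=> *; apply: htp_ext.
- by move=> *; apply: htp_ext.
Qed.

Lemma verdier_laws (T : tricat R) (N : T -> Prop) : cat_laws T -> cat_laws (verdier N).
Proof.
move=> L; split=> /=.
- by move=> *; apply: loc_eq_refl.
- by move=> *; apply: loc_eq_sym.
- by move=> X Y f g h; apply: loc_eq_trans.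
- by move=> *; apply: loc_eq_comp.
- by move=> *; apply: loc_eq_assoc.
- by move=> *; apply: loc_eq_idl.
- by move=> *; apply: loc_eq_idr.
- have idE X : loc_eq (loc_in N (shiftm (idm X))) (loc_in N (idm (shift X))).
    exact/loc_eq_in/cl_shift_id.
  move=> X Y f g; elim=> {X Y f g} /=.
  + by move=> *; apply: loc_eq_refl.
  + by move=> *; apply: loc_eq_sym.
  + by move=> X Y p q r _ e1 _ e2; apply: loc_eq_trans e1 e2.
  + by move=> *; apply: loc_eq_comp.
  + by move=> *; apply: loc_eq_assoc.
  + move=> X Y p; apply: loc_eq_trans (loc_eq_idl _).
    exact/loc_eq_comp/loc_eq_refl.
  + move=> X Y p; apply: loc_eq_trans (loc_eq_idr _).
    exact/loc_eq_comp/idE/loc_eq_refl.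
  + by move=> *; apply/loc_eq_in/cl_shift.
  + move=> X Y Z g f; apply: loc_eq_trans (loc_eq_in_comp _ _ _).
    exact/loc_eq_in/cl_shift_comp.
  + move=> X Y s w; apply: loc_eq_trans (loc_eq_sym (idE _)); exact: loc_eq_invl.
  + move=> X Y s w; apply: loc_eq_trans (loc_eq_sym (idE _)); exact: loc_eq_invr.
- by move=> *; apply: loc_eq_refl.
- by move=> X; apply/loc_eq_in/cl_shift_id.
Qed.

Section Iso.
Variables (C : lincat R) (L : cat_laws C).
Implicit Types X Y Z : C.

Lemma is_iso_id X : is_iso (idm X).
Proof. by exists (idm X); split; apply: cl_idl. Qed.

Lemma is_iso_comp X Y Z (g : Defs.hom Y Z) (f : Defs.hom X Y) :
  is_iso g -> is_iso f -> is_iso (compm g f).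
Proof.
have K (U V W : C) (k : Defs.hom V W) (j : Defs.hom U V) k' j' :
    heq (compm k' k) (idm V) -> heq (compm j' j) (idm U) ->
    heq (compm (compm j' k') (compm k j)) (idm U).
  move=> eg ef; apply: (cl_trans L (cl_sym L (cl_assoc L _ _ _)) _).
  apply: (cl_trans L _ ef); apply: (cl_comp L (cl_refl L _)).
  apply: (cl_trans L (cl_assoc L _ _ _) _).
  exact: (cl_trans L (cl_comp L eg (cl_refl L _)) (cl_idl L _)).
by move=> [g' [e1 e2]] [f' [e3 e4]]; exists (compm f' g'); split; apply: K.
Qed.

Lemma isomorphic_trans X Y Z : isomorphic X Y -> isomorphic Y Z -> isomorphic X Z.
Proof. by move=> [f If] [g Ig]; exists (compm g f); apply: is_iso_comp. Qed.

Lemma isomorphic_sym X Y : isomorphic X Y -> isomorphic Y X.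
Proof. by move=> [f [g fg]]; exists g, f; apply: is_inverse_sym. Qed.

Lemma is_iso_shift X Y (f : Defs.hom X Y) : is_iso f -> is_iso (shiftm f).
Proof.
move=> [g [e1 e2]]; exists (shiftm g); split.
  apply: (cl_trans L (cl_sym L (cl_shift_comp L _ _)) _).
  exact: (cl_trans L (cl_shift L e1) (cl_shift_id L _)).
apply: (cl_trans L (cl_sym L (cl_shift_comp L _ _)) _).
exact: (cl_trans L (cl_shift L e2) (cl_shift_id L _)).
Qed.

Lemma tri_iso_refl X Y Z (f : Defs.hom X Y) (g : Defs.hom Y Z) (h : Defs.hom Z (shift X)) :
  tri_iso f g h f g h.
Proof.
exists (idm X), (idm Y), (idm Z); split; first by split; apply: is_iso_id.
have E (U V : C) (k : Defs.hom U V) : heq (compm (idm V) k) (compm k (idm U)).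
  exact: (cl_trans L (cl_idl L _) (cl_sym L (cl_idr L _))).
split=> //; apply: (cl_trans L _ (E _ _ h)).
exact: (cl_comp L (cl_shift_id L _) (cl_refl L _)).
Qed.

(** Morphisms with a given cone are only known up to isomorphism; this is the
    corresponding closure of a class of morphisms. *)
Definition conj_to (W : forall X Y : C, Defs.hom X Y -> Prop) X Y (s : Defs.hom X Y) : Prop :=
  exists (X' Y' : C) (u : Defs.hom X' Y') (a : Defs.hom X X') (b : Defs.hom Y Y'),
    [/\ W _ _ u, is_iso a, is_iso b & heq (compm b s) (compm u a)].

Variable W : forall X Y : C, Defs.hom X Y -> Prop.

Lemma conj_to_refl X Y (s : Defs.hom X Y) : W s -> conj_to W s.
Proof.
move=> Ws; exists X, Y, s, (idm X), (idm Y); split=> //; try exact: is_iso_id.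
exact: (cl_trans L (cl_idl L _) (cl_sym L (cl_idr L _))).
Qed.

Lemma conj_to_iso X Y X' Y' (s : Defs.hom X Y) (s' : Defs.hom X' Y')
    (a : Defs.hom X' X) (b : Defs.hom Y' Y) :
  is_iso a -> is_iso b -> heq (compm b s') (compm s a) -> conj_to W s' -> conj_to W s.
Proof.
move=> [a' [e1 e2]] [b' [e3 e4]] e [X1 [Y1 [u [c [d [Wu Ic Id e']]]]]].
exists X1, Y1, u, (compm c a'), (compm d b'); split=> //.
- by apply: is_iso_comp => //; exists a.
- by apply: is_iso_comp => //; exists b.
have E : heq (compm b' s) (compm s' a').
  apply: (cl_trans L (cl_comp L (cl_refl L _) (cl_sym L (cl_idr L s))) _).
  apply: (cl_trans L (cl_comp L (cl_refl L _) (cl_comp L (cl_refl L _) (cl_sym L e2))) _).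
  apply: (cl_trans L (cl_comp L (cl_refl L _) (cl_assoc L _ _ _)) _).
  apply: (cl_trans L (cl_comp L (cl_refl L _) (cl_comp L (cl_sym L e) (cl_refl L _))) _).
  apply: (cl_trans L (cl_assoc L _ _ _) _).
  apply: (cl_comp L _ (cl_refl L _)).
  apply: (cl_trans L (cl_assoc L _ _ _) _).
  exact: (cl_trans L (cl_comp L e3 (cl_refl L _)) (cl_idl L _)).
apply: (cl_trans L (cl_sym L (cl_assoc L _ _ _)) _).
apply: (cl_trans L (cl_comp L (cl_refl L _) E) _).
apply: (cl_trans L (cl_assoc L _ _ _) _).
apply: (cl_trans L (cl_comp L e' (cl_refl L _)) _).
exact: (cl_sym L (cl_assoc L _ _ _)).
Qed.

(** With this, the constructor [has_cone_shift] needs no triangle of its own. *)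
Lemma conj_to_shift X Y (s : Defs.hom X Y) :
  (forall (X Y : C) (u : Defs.hom X Y), W u -> W (shiftm u)) ->
  conj_to W s -> conj_to W (shiftm s).
Proof.
move=> sW [X' [Y' [u [a [b [Wu Ia Ib e]]]]]].
exists (shift X'), (shift Y'), (shiftm u), (shiftm a), (shiftm b).
split; [exact: sW | exact: is_iso_shift | exact: is_iso_shift |].
apply: (cl_trans L (cl_sym L (cl_shift_comp L _ _)) _).
exact: (cl_trans L (cl_shift L e) (cl_shift_comp L _ _)).
Qed.

Lemma conj_invertible (rho : rrep C) X Y (s : Defs.hom X Y) :
  (forall (X Y : C) (u : Defs.hom X Y), W u -> invertible rho u) ->
  conj_to W s -> invertible rho s.
Proof.
move=> inv [X' [Y' [u [a [b [Wu Ia Ib e]]]]]].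
exact: invertible_conj Ia Ib e (inv _ _ _ Wu).
Qed.

End Iso.

Lemma loc_in_iso (T : tricat R) (N : T -> Prop) (X Y : T) (f : Defs.hom X Y) :
  is_iso f -> @is_iso R (verdier N) X Y (loc_in N f).
Proof.
move=> [g [e1 e2]]; exists (loc_in N g); split.
  exact: loc_eq_trans (loc_eq_sym (loc_eq_in_comp _ _ _)) (loc_eq_in _ e1).
exact: loc_eq_trans (loc_eq_sym (loc_eq_in_comp _ _ _)) (loc_eq_in _ e2).
Qed.

End Laws.

(** * The derived category *)

Section Derived.
Variable R : comNzRingType.
Let K := homotopy_category R.
Let D := derived_category R.
Let LK := homotopy_laws R.
Let LD : cat_laws D := verdier_laws (@acyclic R : K -> Prop) LK.
Implicit Types X Y Z : cplx R.

(** Allows every statement about a degree to be proved in degrees [j + 1] only. *)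
Lemma ex_pred (i : int) : exists j, i = j + 1.
Proof. by exists (i - 1); rewrite subrK. Qed.

Lemma all_succ (P : int -> Prop) : (forall i : int, P (i + 1)) -> forall i, P i.
Proof. by move=> H i; have [j ->] := ex_pred i. Qed.

Lemma cone_qis X Y (f : chain_map X Y) : acyclic (cone f) -> qis f.
Proof.
move=> ac; split=> [i x y dx fx|i y dy].
  have [j ei] := ex_pred i; subst i.
  have [|[a b] /= [ea _]] := ac j (x, - y).
    by apply: pair_ext => /=; rewrite ?diffN ?dx ?fx ?oppr0 ?subrr.
  by exists (- a); rewrite diffN ea.
have [|[a b] /= [ea eb]] := ac i (0, y).
  by apply: pair_ext => /=; rewrite ?zeroE ?dy ?oppr0 ?addr0.
exists a, b; split=> //; by apply: oppr_inj; rewrite ea oppr0.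
Qed.

Lemma htp_cocycle X Y (f g : chain_map X Y) (i : int) (x : X (i + 1)) :
  homotopic f g -> diff X _ x = 0 -> exists y, f _ x = g _ x + diff Y i y.
Proof.
move=> [h H] dx; exists (h i x); have := H i x; rewrite dx linear0 addr0 => <-.
zmod.
Qed.

Lemma htp_iso_qis X Y (f : chain_map X Y) : @is_iso R K X Y f -> qis f.
Proof.
move=> [g [gf fg]]; split=> [i x y dx fx|i y dy].
  have [z /= ez] := htp_cocycle gf dx; exists (g _ y - z).
  by rewrite addE addE -cm_diff -fx ez; zmod.
have [z /= ez] := htp_cocycle fg dy; exists (g _ y), (- z); split.
  by rewrite -cm_diff dy cm0.
by rewrite ez diffN; zmod.
Qed.

Lemma acyclic_qis : forall X Y (f : chain_map X Y), qis f -> acyclic X <-> acyclic Y.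
Proof.
move=> X Y f [inj srj]; split=> ac i.
  move=> y /srj [x [y' [/ac [x' <-] ->]]]; exists (f _ x' + y').
  by rewrite diffD cm_diff.
move=> x dx; have [|y fx] := ac i (f _ x); first by rewrite -cm_diff dx cm0.
by have [x' ->] := inj _ _ _ dx (esym fx); exists x'.
Qed.

Lemma acyclic_shift X : acyclic X <-> acyclic (cplx_shift X).
Proof.
split=> ac i.
  move=> x /= /eqP; rewrite oppr_eq0 => /eqP/ac [y <-].
  by exists (- y); rewrite /= diffN opprK.
have [{}i ->] := ex_pred i.
move=> x dx; have [|y /= <-] := ac i x; first by rewrite /= dx oppr0.
by exists (- y); rewrite diffN.
Qed.

Lemma acyclic_tri_stable : tri_stable (@acyclic R).
Proof.
split=> //.
- exact: acyclic_qis.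
- exact: acyclic_shift.
- move=> X Y f aX aY; apply: qis_cone; split=> [i x y dx _|i y /aY [y' <-]].
    by have [x' <-] := aX _ _ dx; exists x'.
  by exists 0, y'; rewrite !zeroE add0r.
Qed.

Lemma cone_exact X Y (f : chain_map X Y) :
  @exact_tri R K X Y (cone f) f (cone_in f) (cone_out f).
Proof. by exists X, Y, f; apply: tri_iso_refl. Qed.

Lemma loc_in_exact (T : tricat R) (N : T -> Prop) (X Y Z : T) (f : Defs.hom X Y)
    (g : Defs.hom Y Z) (h : Defs.hom Z (shift X)) :
  cat_laws T -> exact_tri f g h ->
  @exact_tri R (verdier N) X Y Z (loc_in N f) (loc_in N g) (loc_in N h).
Proof.
by move=> L fgh; exists X, Y, Z, f, g, h; split=> //; apply/tri_iso_refl/verdier_laws.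
Qed.

Lemma loc_in_inverse (T : tricat R) (N : T -> Prop) (X Y : T) (f : Defs.hom X Y) :
  has_cone_in N f -> @is_iso R (verdier N) X Y (loc_in N f).
Proof. by move=> w; exists (loc_inv w); split; [apply: loc_eq_invl|apply: loc_eq_invr]. Qed.

Lemma qis_iso X Y (f : chain_map X Y) : qis f -> @isomorphic R D X Y.
Proof.
move=> /qis_cone af; exists (loc_in (T := K) (@acyclic R) (f : Defs.hom (l := K) X Y)).
exact/loc_in_inverse/(has_cone (cone_exact f)).
Qed.

(** The zero endomorphism z of an acyclic complex is a quasi-isomorphism, hence
    invertible, and z z = z forces z = 1. *)
Lemma acyclic_zero X : acyclic X -> @is_zero R D X.
Proof.
move=> aX; rewrite /is_zero /=.
pose z : Defs.hom (l := K) X X := cm_zero X X.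
have w : has_cone_in (T := K) (@acyclic R) z.
  apply: has_cone (cone_exact _) _; exact: (ts_cone acyclic_tri_stable).
have zz : loc_eq (loc_in (T := K) (@acyclic R) z) (loc_comp (loc_in _ z) (loc_in _ z)).
  apply: loc_eq_trans (loc_eq_in_comp _ _ _); apply: loc_eq_in.
  exact: htp_ext.
have e := loc_eq_sym (loc_eq_invl w).
apply: loc_eq_trans e _.
apply: loc_eq_trans (loc_eq_comp (loc_eq_refl _) zz) _.
apply: loc_eq_trans (loc_eq_assoc _ _ _) _.
apply: loc_eq_trans (loc_eq_comp (loc_eq_invl w) (loc_eq_refl _)) _.
exact: loc_eq_idl.
Qed.

(** ** Thick subcategories *)

Section ThickStable.
Variable P : D -> Prop.
Hypothesis thP : is_thick P.

(** Closure under isomorphism comes from closure under summands, with the acyclic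
    cone of an identity as the complement. *)
Lemma thick_iso X Y : @isomorphic R D X Y -> P X -> P Y.
Proof.
case: thP => _ _ _ sumP XY; apply: sumP; exists (cone (cm_id Y)).
apply: isomorphic_trans XY _; first exact: LD.
apply: (qis_iso (f := dsum_inl Y (cone (cm_id Y)))); split=> [i x [y z] dx [/= -> _]|i [y z] dyz].
  by exists y.
have dy := congr1 fst dyz; have [|z' <-] := @acyclic_cone_id _ Y i z.
  exact: (congr1 snd dyz).
by exists y, (0, z'); split=> //; apply: pair_ext; rewrite /= ?diff0 ?addr0 ?add0r.
Qed.

Lemma thick_tri_stable : tri_stable P.
Proof.
have [zP shP coneP _] := thP; split.
- by move=> X /acyclic_zero/zP.
- move=> X Y f /qis_iso XY; split; apply: thick_iso => //.
  exact: isomorphic_sym.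
- exact: shP.
- move=> X Y f PX PY; apply: (coneP X Y (cone f)) PX PY.
  exact: (loc_in_exact (T := K) (@acyclic R) LK (cone_exact f)).
Qed.

End ThickStable.

Lemma thick_is_thick (G : D) : is_thick (thick G).
Proof.
split.
- by move=> X zX P [zP _ _ _] _; apply: zP.
- move=> X; split=> tX P thP PG; have [_ shP _ _] := thP.
    by apply: (shP X).1; apply: tX.
  by apply: (shP X).2; apply: tX.
- move=> X Y Z f g h fgh tX tY P thP PG; case: (thP) => _ _ coneP _.
  by apply: coneP fgh _ _; [apply: tX | apply: tY].
- move=> Y Z YZ tZ P thP PG; case: (thP) => _ _ _ sumP.
  by apply: sumP YZ _; apply: tZ.
Qed.

(** ** Morphisms of the derived category with a given cone *)

Section DerivedCone.
Variable N : cplx R -> Prop.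
Hypothesis NP : tri_stable N.
Hypothesis N_iso : forall X Y, @isomorphic R D X Y -> N X -> N Y.

Definition wkD (X Y : D) (p : Defs.hom X Y) : Prop :=
  exists u : chain_map X Y, wk N u /\ p = loc_in (T := K) (@acyclic R) u.

Lemma wkD_shift (X Y : D) (p : Defs.hom X Y) : wkD p -> wkD (shiftm p).
Proof. by move=> [u [Nu ->]]; exists (cm_shift u); split=> //; apply/(wk_shift NP). Qed.

(** An exact triangle of the derived category is isomorphic there to one of the
    homotopy category, which is itself isomorphic to the triangle of a cone. *)
Lemma exact_conj (X Y Z : D) (p : Defs.hom X Y) (q : Defs.hom Y Z) r :
  exact_tri p q r -> N Z -> conj_to wkD p.
Proof.
move=> [X' [Y' [Z' [f [g [h [[X1 [Y1 [u iso1]]] iso2]]]]]]] NZ.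
case: iso1 => a1 [b1 [c1 [[Ia1 Ib1 Ic1] [e1 _ _]]]].
case: iso2 => a2 [b2 [c2 [[Ia2 Ib2 Ic2] [e2 _ _]]]].
apply: (conj_to_iso LD Ia2 Ib2 e2).
pose l (V W : K) (k : Defs.hom V W) : @Defs.hom R D V W := loc_in (T := K) (@acyclic R) k.
have e : loc_eq (loc_comp (l _ _ b1) (l _ _ u)) (loc_comp (l _ _ f) (l _ _ a1)).
  have E1 := loc_eq_in_comp (T := K) (@acyclic R) b1 u.
  have E2 := loc_eq_in_comp (T := K) (@acyclic R) f a1.
  have E := loc_eq_in (T := K) (@acyclic R) e1.
  exact: (loc_eq_trans (loc_eq_sym E1) (loc_eq_trans E E2)).
have Ia := loc_in_iso (T := K) (@acyclic R) Ia1.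
have Ib := loc_in_iso (T := K) (@acyclic R) Ib1.
refine (@conj_to_iso R D LD (@wkD) X' Y' X1 Y1 _ (l _ _ u) (l _ _ a1) (l _ _ b1) Ia Ib e _).
apply: conj_to_refl => //; exists u; split=> //.
apply: N_iso NZ; apply: (@isomorphic_sym _ D).
apply: (isomorphic_trans (Y := Z') LD); last by exists c2.
by exists (loc_in (T := K) _ c1); apply: loc_in_iso.
Qed.

End DerivedCone.

Definition wkK (X Y : K) (u : Defs.hom X Y) : Prop := acyclic (cone u).

Lemma has_cone_acyclic (X Y : K) (s : Defs.hom X Y) :
  has_cone_in (T := K) (@acyclic R) s -> conj_to wkK s.
Proof.
elim=> {X Y s} [X Y Z f g h [X' [Y' [u [a [b [c [[Ia Ib [d [e1 e2]]] [e _ _]]]]]]]] aZ|X Y s _].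
  apply: (conj_to_iso LK Ia Ib e); apply: conj_to_refl => //.
  by apply/(acyclic_qis (htp_iso_qis (f := c) _)) => //; exists d.
by apply: (conj_to_shift LK) => X1 Y1 u au; apply/(wk_shift acyclic_tri_stable).
Qed.

End Derived.

(** * Finitely generated cohomology *)

Section Cohomology.
Variable R : comNzRingType.
Implicit Types X Y Z : cplx R.

Inductive bd X : forall j : int, X j -> Prop := Bd (i : int) (y : X i) : bd (diff X i y).

(** Inversion of [bd]; integers have unique identity proofs. *)
Lemma bdP X (i : int) (x : X (i + 1)) : bd x <-> exists y, x = diff X i y.
Proof.
split=> [b|[y ->]]; last exact: Bd.
suff G (j : int) (w : X j) : bd w ->
    forall i (e : j = i + 1), exists y, ecast j (X j) e w = diff X i y.
  exact: G b i (erefl _).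
move=> bw; case: j w / bw => j y k e; have ejk : j = k by apply: (addIr 1).
by case: _ / ejk in e *; exists y; rewrite (eq_irrelevance e (erefl _)).
Qed.

(** A family of submodules, one in each degree. *)
Definition submods X (P : forall i : int, X i -> Prop) : Prop :=
  forall i : int, P i 0 /\ forall (a : R) x y, P i x -> P i y -> P i (a *: x + y).

Section Submods.
Variables (X : cplx R) (P : forall i : int, X i -> Prop) (sP : submods P).

Lemma submods0 (i : int) : P (0 : X i). Proof. exact: (sP i).1. Qed.

Lemma submodsP (i : int) a (x y : X i) : P x -> P y -> P (a *: x + y).
Proof. exact: (sP i).2. Qed.

Lemma submodsZ (i : int) a (x : X i) : P x -> P (a *: x).
Proof. by move=> Px; rewrite -[_ *: _]addr0; apply: submodsP => //; apply: submods0. Qed.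

Lemma submodsD (i : int) (x y : X i) : P x -> P y -> P (x + y).
Proof. by move=> Px Py; rewrite -[x]scale1r; apply: submodsP. Qed.

Lemma submodsN (i : int) (x : X i) : P x -> P (- x).
Proof. by move=> Px; rewrite -scaleN1r; apply: submodsZ. Qed.

Lemma submodsB (i : int) (x y : X i) : P x -> P y -> P (x - y).
Proof. by move=> Px Py; apply: submodsD => //; apply: submodsN. Qed.

Lemma submods_sum (i : int) (I : Type) (s : seq I) (F : I -> X i) :
  (forall k, P (F k)) -> P (\sum_(k <- s) F k).
Proof.
by move=> PF; elim/big_rec: _ => [|k x _]; [apply: submods0 | apply: submodsD].
Qed.

End Submods.

Lemma submods_bd X : submods (@bd X).
Proof.
apply: all_succ => i; split=> [|a x y].
  by apply/bdP; exists 0; rewrite diff0.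
move=> /bdP[x' ->] /bdP[y' ->]; apply/bdP; exists (a *: x' + y').
by rewrite linearP.
Qed.

Definition coc X (i : int) (x : X i) : Prop := diff X i x = 0.

Lemma submods_coc X : submods (@coc X).
Proof.
by move=> i; split=> [|a x y]; rewrite /coc ?diff0 // linearP => -> ->; rewrite scaler0 addr0.
Qed.

Lemma bd_coc X (i : int) (x : X i) : bd x -> coc x.
Proof. by case=> j y; rewrite /coc diffK. Qed.

Definition delta X (i : int) (z : X i) (j : int) : X j :=
  match i =P j with
  | ReflectT e => ecast j (X j) e z
  | ReflectF _ => 0
  end.

Lemma delta_id X (i : int) (z : X i) : delta z i = z.
Proof. by rewrite /delta; case: eqP => // e; rewrite (eq_irrelevance e (erefl _)). Qed.

Lemma delta_ne X (i j : int) (z : X i) : i != j -> delta z j = 0.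
Proof. by rewrite /delta; case: eqP. Qed.

Lemma deltaP X (i j : int) (a : R) (x y : X i) :
  delta (a *: x + y) j = a *: delta x j + delta y j.
Proof. by rewrite /delta; case: eqP => [e|_]; [case: _ / e | rewrite scaler0 addr0]. Qed.

Lemma delta0 X (i j : int) : delta (0 : X i) j = 0.
Proof. by rewrite /delta; case: eqP => // e; case: _ / e. Qed.

(** ** Lists of homogeneous elements *)

Definition helt X := {i : int & X i}.
Definition hseq X := seq (helt X).
Definition homog X (i : int) (x : X i) : helt X := existT _ i x.

Fixpoint allL X (P : forall i : int, X i -> Prop) (L : hseq X) : Prop :=
  if L is u :: L' then P (tag u) (tagged u) /\ allL P L' else True.

Lemma allL_cat X (P : forall i : int, X i -> Prop) (L L' : hseq X) :
  allL P (L ++ L') <-> allL P L /\ allL P L'.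
Proof. by elim: L => [|u L IH] /=; [tauto | rewrite IH; tauto]. Qed.

Lemma allL_map X (P : forall i : int, X i -> Prop) (T : eqType) (s : seq T)
    (f : T -> helt X) :
  allL P (map f s) <-> forall t, t \in s -> P (tag (f t)) (tagged (f t)).
Proof.
elim: s => [|t s IH] //=; rewrite IH; split=> [[Pt Ps] t'|H].
  by rewrite inE => /predU1P[->|/Ps].
by split=> [|t' ts]; apply: H; rewrite inE ?eqxx ?ts ?orbT.
Qed.

Lemma allL_impl X (P Q : forall i : int, X i -> Prop) (L : hseq X) :
  (forall (i : int) x, P i x -> Q i x) -> allL P L -> allL Q L.
Proof. by move=> PQ; elim: L => //= u L IH [/PQ ? /IH]. Qed.

(** Generation of the cohomology. Quantifying over all graded submodules avoids
    linear combinations of elements of different degrees. *)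
Definition gen X (L : hseq X) : Prop :=
  forall P : forall i : int, X i -> Prop, submods P ->
    (forall (i : int) x, bd x -> P i x) -> allL P L -> forall (i : int) x, coc x -> P i x.

Definition fgH X : Prop := exists L : hseq X, allL (@coc X) L /\ gen L.

Definition span X (B : forall i : int, X i -> Prop) (L : hseq X) (i : int) (x : X i) : Prop :=
  forall P : forall i : int, X i -> Prop, submods P ->
    (forall (i : int) x, B i x -> P i x) -> allL P L -> P i x.

Lemma submods_span X (B : forall i : int, X i -> Prop) L : submods (span B L).
Proof.
move=> i; split=> [|a x y sx sy] P sP PB PL; first exact: (submods0 sP).
by apply: (submodsP sP); [exact: (sx P) | exact: (sy P)].
Qed.

Lemma allL_span X (B : forall i : int, X i -> Prop) (L : hseq X) : allL (span B L) L.
Proof.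
have G L' : (forall P : forall i : int, X i -> Prop, allL P L -> allL P L') -> allL (span B L) L'.
  elim: L' => //= u L' IH H; split; last by apply: IH => P /H [].
  by move=> P _ _ /H [].
exact: G.
Qed.

(** Hilbert's argument. When the generator z is added to a list, consider the ideal
    of all a such that a z + y is in [Q] for some y spanned by the rest: lifts of
    generators of this ideal, together with generators for the rest of the list,
    generate the part of [Q] inside the span. *)
Lemma noetherian_span X (B Q : forall i : int, X i -> Prop) (L : hseq X) :
  noetherian R -> submods Q ->
  exists L', allL Q L' /\ forall (i : int) x, Q i x -> span B L x -> span B L' x.
Proof.
move=> noeth sQ; elim: L => [|[i0 z] L [L' [QL' LL']]]; first by exists [::].
(* The ideal of coefficients of z occurring in Q modulo the rest of the list. *)
pose I (a : R) := exists y, span B L y /\ Q i0 (a *: z + y).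
have sS := submods_span B L.
have idI : is_ideal I.
  split.
  - by exists 0; split; [apply: (submods0 sS) | rewrite scale0r addr0; apply: (submods0 sQ)].
  - move=> a b [y [Sy Qy]] [y' [Sy' Qy']]; exists (y + y'); split; first exact: (submodsD sS).
    by rewrite scalerDl addrACA; apply: (submodsD sQ).
  - move=> b a [y [Sy Qy]]; exists (b *: y); split; first exact: (submodsZ sS).
    by rewrite -scalerA -scalerDr; apply: (submodsZ sQ).
have [n [g [Ig gI]]] := noeth I idI.
have [y Hy] := choice Ig.
pose u k := homog (g k *: z + y k).
exists (map u (enum 'I_n) ++ L'); split.
  by apply/allL_cat; split=> //; apply/allL_map => k _; case: (Hy k).
move=> i x Qx Sx P sP PB /allL_cat [/allL_map Pu PL'].
have {}Pu k : P i0 (g k *: z + y k) by apply: (Pu k); rewrite mem_enum.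
have [a Sa] : exists a, span B L (x - delta (a *: z) i).
  apply: (Sx (fun j x => exists a, span B L (x - delta (a *: z) j))).
  - move=> j; split=> [|c v w [a Sv] [b Sw]].
      by exists 0; rewrite scale0r delta0 subr0; apply: (submods0 sS).
    exists (c * a + b); rewrite scalerDl -scalerA deltaP.
    have -> : c *: v + w - (c *: delta (a *: z) j + delta (b *: z) j) =
              c *: (v - delta (a *: z) j) + (w - delta (b *: z) j).
      by rewrite scalerBr; zmod.
    exact: (submodsP sS).
  - move=> j v Bv; exists 0; rewrite scale0r delta0 subr0 => P' sP' PB' _; exact: PB'.
  - split=> /=.
      by exists 1; rewrite scale1r delta_id subrr; apply: (submods0 sS).
    apply: allL_impl (allL_span B L) => j v Sv; exists 0; by rewrite scale0r delta0 subr0.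
case: (eqVneq i0 i) => [e|ne]; last first.
  move: Sa; rewrite delta_ne // subr0 => Sx'.
  exact: (LL' _ _ Qx Sx' P).
case: _ / e in x Qx Sx Sa *; rewrite delta_id in Sa.
have Ia : I a by exists (x - a *: z); split=> //; rewrite addrC subrK.
have [b ea] := gI a Ia.
pose w := \sum_k b k *: (g k *: z + y k).
have -> : x = w + (x - w) by rewrite addrC subrK.
apply: (submodsD sP); first by apply: (submods_sum sP) => k; apply: (submodsZ sP).
apply: LL' => //.
  apply: (submodsB sQ) => //; apply: (submods_sum sQ) => k; apply: (submodsZ sQ).
  by case: (Hy k).
have -> : x - w = (x - a *: z) - \sum_k b k *: y k.
  rewrite /w ea scaler_suml -addrA -opprD; congr (_ - _).
  by rewrite -big_split; apply: eq_bigr => k _; rewrite scalerDr scalerA.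
apply: (submodsB sS) => //; apply: (submods_sum sS) => k; apply: (submodsZ sS).
by case: (Hy k).
Qed.

End Cohomology.

Section FgTotal.
Variable R : comNzRingType.
Implicit Types X Y Z : cplx R.

Definition degrees (N : nat) : seq int :=
  map Posz (iota 0 N.+1) ++ map (fun m : nat => - Posz m) (iota 0 N.+1).

Lemma mem_degrees (N : nat) (i : int) : (`|i| <= N)%N -> i \in degrees N.
Proof.
rewrite mem_cat => iN; apply/orP; case: i iN => m mN; [left | right].
  by apply: map_f; rewrite mem_iota.
by rewrite NegzE; apply: (map_f (fun k : nat => - Posz k)); rewrite mem_iota.
Qed.

Lemma delta_coc X (i : int) (z : X i) (j : int) : coc z -> coc (delta z j).
Proof.
move=> dz; case: (eqVneq i j) => [<-|ne]; first by rewrite delta_id.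
by rewrite delta_ne // /coc diff0.
Qed.

(** The components of the generating families, in the finitely many degrees where
    they can be nonzero, generate. *)
Lemma fgH_of_fg X : fg_total_cohomology X -> fgH X.
Proof.
move=> [n [g [cg gg]]].
have /choice [N gN] k : exists N : nat, forall i : int, (N < `|i|)%N -> g k i = 0.
  exact: (cg k).2.
pose M := \max_k N k.
pose f (t : 'I_n * int) : helt X := homog (g t.1 t.2).
pose s := [seq (k, i) | k <- enum 'I_n, i <- degrees M].
exists (map f s); split; first by apply/allL_map => t _; apply: (cg t.1).1.
move=> P sP Pbd /allL_map PL i x cx.
have Pg k j : P j (g k j).
  have [jM|Mj] := leqP `|j|%N M.
    by apply: (PL (k, j)); apply: allpairs_f; rewrite ?mem_enum // mem_degrees.
  rewrite gN; first exact: (submods0 sP).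
  by apply: leq_ltn_trans Mj; apply: leq_bigmax.
have [|a Ha] := gg (delta x).
  split=> [j|]; first exact: delta_coc.
  by exists `|i|%N => j ij; apply: delta_ne; apply: contraTneq ij => ->; rewrite ltnn.
have [j ei] := ex_pred i; subst i; have [y] := Ha j; rewrite delta_id => ->.
apply: (submodsD sP); last exact/Pbd/Bd.
by apply: (submods_sum sP) => k; apply: (submodsZ sP).
Qed.

(** The families concentrated in one degree that are equal to a generator generate:
    a finitely supported family is the sum of its components. *)
Lemma fg_of_fgH X : fgH X -> fg_total_cohomology X.
Proof.
move=> [L [cL gL]].
have allLP (P : forall i : int, X i -> Prop) :
    allL P L <-> forall k : 'I_(size L), P _ (tagged (tnth (in_tuple L) k)).
  have E := @allL_map R X P _ (enum 'I_(size L)) (tnth (in_tuple L)).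
  have EL : map (tnth (in_tuple L)) (enum 'I_(size L)) = L by exact: map_tnth_enum.
  rewrite EL in E; rewrite E; split=> H k; first by apply: H; rewrite mem_enum.
  by move=> _; apply: H.
pose g k := delta (tagged (tnth (in_tuple L) k)).
exists (size L), g; split=> [k|z [cz [N zN]]].
  move/allLP: cL => /(_ k) ck; split=> [i|]; first exact: delta_coc.
  exists `|tag (tnth (in_tuple L) k)|%N => j ij; apply: delta_ne.
  by apply: contraTneq ij => ->; rewrite ltnn.
pose Q (u : forall j : int, X j) := exists a : 'I_(size L) -> R, forall i : int, exists y,
  u (i + 1) = \sum_k a k *: g k (i + 1) + diff X i y.
have Q0 : Q (fun j => 0).
  exists (fun=> 0) => i; exists 0; rewrite diff0 addr0 big1 // => k _.
  by rewrite scale0r.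
have QP c u v : Q u -> Q v -> Q (fun j => c *: u j + v j).
  move=> [a Ha] [b Hb]; exists (fun k => c * a k + b k) => i.
  have [[y ->] [y' ->]] := (Ha i, Hb i); exists (c *: y + y').
  rewrite linearP scalerDr addrACA scaler_sumr -big_split; congr (_ + _).
  by apply: eq_bigr => k _; rewrite scalerDl scalerA.
have Qext (u v : forall j : int, X j) : (forall j, u j = v j) -> Q u -> Q v.
  by move=> uv [a Ha]; exists a => i; have [y e] := Ha i; exists y; rewrite -uv.
have Qz (j : int) x : coc x -> Q (@delta R X j x).
  apply: (gL (fun j x => Q (delta x))).
  - move=> j'; split=> [|c v w /(QP c) H /H].
      by apply: Qext Q0 => k; rewrite delta0.
    by apply: Qext => k; rewrite deltaP.
  - move=> _ _ [i y]; exists (fun=> 0) => k.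
    under eq_bigr => l _ do rewrite scale0r.
    rewrite big1 //; case: (eqVneq i k) => [<-|ne].
      by exists y; rewrite delta_id add0r.
    by exists 0; rewrite delta_ne ?diff0 ?addr0 // (inj_eq (addIr 1)).
  apply/allLP => k; exists (fun l => (l == k)%:R) => i; exists 0.
  rewrite (bigD1 k) //= eqxx scale1r big1 ?addr0 ?diff0 ?addr0 // => l /negbTE->.
  by rewrite scale0r.
have : Q (fun i => \sum_(j <- undup (degrees N)) delta (z j) i).
  elim: (undup _) => [|j s IH]; first by apply: Qext Q0 => k; rewrite big_nil.
  apply: Qext (QP 1 _ _ (Qz j _ (cz j)) IH) => k.
  by rewrite big_cons scale1r.
apply: Qext => i; have [iN|Ni] := leqP `|i|%N N.
  rewrite (bigD1_seq i) ?undup_uniq ?mem_undup ?mem_degrees //= delta_id.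
  by rewrite big1 ?addr0 // => j ji; rewrite delta_ne.
rewrite zN // big1 // => j _; case: (eqVneq j i) => [->|ji].
  by rewrite zN // delta0.
exact: delta_ne.
Qed.

End FgTotal.

Section Unshift.
Variable R : comNzRingType.
Implicit Types X Y Z V : cplx R.

(** Defines a family over all degrees from one over the degrees [i + 1], with a
    computation rule there, so that no transport appears in later proofs. *)
Definition unsh (P : int -> Type) (F : forall i : int, P (i + 1)) (j : int) : P j :=
  ecast k (P k) (subrK 1 j) (F (j - 1)).

Lemma unshE (P : int -> Type) (F : forall i : int, P (i + 1)) (i : int) : unsh F (i + 1) = F i.
Proof.
have e : i + 1 - 1 = i by rewrite addrK.
rewrite /unsh; move: (subrK _ _); rewrite e => e'.
by rewrite (eq_irrelevance e' (erefl _)).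
Qed.

Lemma bd_shift X (i : int) (x : X (i + 1)) : @bd R (cplx_shift X) i x <-> bd x.
Proof.
have [j ei] := ex_pred i; subst i; rewrite !bdP; split=> -[y ->]; exists (- y);
  by rewrite /= diffN ?opprK.
Qed.

Lemma coc_shift X (i : int) (x : X (i + 1)) : @coc R (cplx_shift X) i x <-> coc x.
Proof. by rewrite /coc /=; split=> [/eqP|->]; rewrite ?oppr0 ?oppr_eq0 // => /eqP. Qed.

Lemma fgH_shift X : fgH X <-> fgH (cplx_shift X).
Proof.
split=> [[L [cL gL]]|[L [cL gL]]].
  have [L' [cL' LL']] : exists L' : hseq (cplx_shift X), allL (@coc _ _) L' /\
      forall P : forall i : int, cplx_shift X i -> Prop, allL P L' ->
        allL (fun j (x : X j) => unsh (P := fun j => X j -> Prop) P j x) L.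
    elim: L cL {gL} => [_|[j x] L IH [/= cx /IH [L' [cL' LL']]]]; first by exists [::].
    have [i ej] := ex_pred j; subst j.
    exists (@homog _ (cplx_shift X) i x :: L'); split.
      by split=> //; apply/coc_shift.
    by move=> P [/= Px /LL']; rewrite unshE.
  exists L'; split=> // P sP Pbd /LL' PL i x /coc_shift cx.
  have := gL (unsh (P := fun j => X j -> Prop) P) _ _ PL _ _ cx; rewrite unshE; apply.
    by apply: all_succ => j; rewrite unshE; apply: sP.
  by apply: all_succ => j y; rewrite unshE => /bd_shift/Pbd.
pose up (u : helt (cplx_shift X)) : helt X := @homog _ X (tag u + 1) (tagged u).
have upE (P : forall i : int, X i -> Prop) :
    allL P (map up L) <-> allL (fun i (x : cplx_shift X i) => P (i + 1) x) L.
  by elim: (L) => //= u s ->.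
exists (map up L); split.
  by apply/upE; apply: allL_impl cL => i x /coc_shift.
move=> P sP Pbd /upE PL; apply: all_succ => i x /coc_shift.
apply: gL (fun i (x : cplx_shift X i) => P (i + 1) x) _ _ PL i x.
  by move=> j; apply: sP.
by move=> j y /bd_shift/Pbd.
Qed.

Lemma fgH_acyclic X : acyclic X -> fgH X.
Proof.
move=> aX; exists [::]; split=> // P _ Pbd _; apply: all_succ => i x /aX [y <-].
exact/Pbd/Bd.
Qed.

(** The cohomology of the cone is an extension of a submodule of that of [X[1]] by a
    quotient of that of [Y]. The submodule consists of the classes that [f] maps to
    zero; it is finitely generated by [noetherian_span], and its generators lift to
    cocycles of the cone. *)
Lemma fgH_cone X Y (f : chain_map X Y) : noetherian R -> fgH X -> fgH Y -> fgH (cone f).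
Proof.
move=> noeth /fgH_shift [LX [cX gX]] [LY [cY gY]].
pose Q (i : int) (x : cplx_shift X i) := coc x /\ exists y, f (i + 1) x = diff Y i y.
have sQ : submods Q.
  move=> i; split=> [|a x x' [cx [y fx]] [cx' [y' fx']]].
    by split; [apply: (submods0 (@submods_coc _ _)) | exists 0; rewrite /= cm0 diff0].
  split; first exact: (submodsP (@submods_coc _ _)).
  by exists (a *: y + y'); rewrite !linearP fx fx'.
have [L [QL LL]] := noetherian_span (@bd _ (cplx_shift X)) LX noeth sQ.
have [L' [cL' LL']] : exists L' : hseq (cone f), allL (@coc _ _) L' /\
    forall P : forall i : int, cone f i -> Prop, allL P L' ->
      allL (fun i (x : cplx_shift X i) =>
        exists y : Y i, P i (x, y) /\ @coc _ (cone f) i (x, y)) L.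
  elim: L QL {LL} => [_|[i x] L IH [/= [cx [y fx]] /IH [L' [cL' LL']]]]; first by exists [::].
  have cxy : @coc _ (cone f) i (x, - y).
    by apply: pair_ext; rewrite /= ?diffN ?fx ?subrr //; exact: cx.
  by exists (@homog _ (cone f) i (x, - y) :: L'); split=> // P [/= Pxy /LL' PL];
    split=> //; exists (- y).
pose inr (u : helt Y) : helt (cone f) := @homog _ (cone f) (tag u) (0, tagged u).
have inrE (P : forall i : int, cone f i -> Prop) :
    allL P (map inr LY) <-> allL (fun i (y : Y i) => P i (0, y)) LY.
  by elim: (LY) => //= u s ->.
have addC (i : int) a (x x' : X (i + 1)) (y y' : Y i) :
   (a *: x + x', a *: y + y') = a *: ((x, y) : cone f i) + (x', y') by [].
exists (L' ++ map inr LY); split.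
  apply/allL_cat; split=> //; apply/inrE; apply: allL_impl cY => i y dy.
  by apply: pair_ext; rewrite /= ?diff0 ?oppr0 ?cm0 ?add0r.
move=> P sP Pbd /allL_cat [/LL' PL /inrE PY] i [x y] cxy.
have dx : @coc _ (cplx_shift X) i x by apply: (congr1 fst cxy).
have fx : f _ x = diff Y i (- y).
  by rewrite diffN; apply/addr0P; apply: (congr1 snd cxy).
have [||||y' [Pxy' cxy']] := LL i x _ _ _ _ _ PL.
- by split=> //; exists (- y).
- by move=> P' sP' bP' PL'; apply: gX.
- move=> j; split.
    exists 0; split; first exact: (submods0 sP).
    exact: (submods0 (@submods_coc _ (cone f))).
  move=> a v v' [w [Pw cw]] [w' [Pw' cw']]; exists (a *: w + w'); rewrite addC.
  split; first exact: (submodsP sP).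
  exact: (submodsP (@submods_coc _ (cone f))).
- move=> j v; have [k ej] := ex_pred j; subst j => /bdP [w ->].
  exists (f _ w); have e : (diff (cplx_shift X) k w, f _ w) = diff (cone f) k (w, 0).
    by apply: pair_ext; rewrite /= ?diff0 ?addr0.
  by rewrite e; split; [apply/Pbd/Bd | apply/bd_coc/Bd].
have -> : (x, y) = ((x, y') : cone f i) + (0, y - y').
  by apply: pair_ext; rewrite /= ?addr0 // addrC subrK.
apply: (submodsD sP) => //.
apply: (gY (fun i (y : Y i) => P i (0, y))) => //.
- move=> j; split; first exact: (submods0 sP).
  move=> a v w Pv Pw; have := submodsP sP a Pv Pw.
  by congr (P _ _); apply: pair_ext; rewrite /= ?scaler0 ?addr0.
- move=> j v; have [k ej] := ex_pred j; subst j => /bdP [w ->]; apply: Pbd.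
  apply/bdP; exists (0, w); by apply: pair_ext; rewrite /= ?diff0 ?oppr0 ?cm0 ?add0r.
have {}cxy' := congr1 snd cxy'; rewrite /= fx diffN in cxy'.
by rewrite /coc !addE; zuse cxy'.
Qed.

End Unshift.

(** * Cohomology of the derived category *)

Lemma addKl (V : zmodType) (x y : V) : x + y - x = y.
Proof. zmod. Qed.

Section DerivedCohomology.
Variable R : comNzRingType.
Let K := homotopy_category R.
Let D := derived_category R.
Implicit Types X Y Z : cplx R.

(** The degree [j] cohomology functor, on cocycles up to boundaries. *)
Definition coh_rel (j : int) X Y (f : chain_map X Y) (x : X j) (y : Y j) : Prop :=
  [/\ coc x, coc y & bd (y - f j x)].

Let sB X := @submods_bd R X.

Lemma cm_bd X Y (f : chain_map X Y) (j : int) (x : X j) : bd x -> bd (f j x).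
Proof. by case=> i y; rewrite cm_diff; apply: Bd. Qed.

Lemma cm_coc X Y (f : chain_map X Y) (j : int) (x : X j) : coc x -> coc (f j x).
Proof. by move=> cx; rewrite /coc -cm_diff cx cm0. Qed.

Lemma bd_trans X (j : int) (x y z : X j) : bd (x - y) -> bd (y - z) -> bd (x - z).
Proof. by move=> b1 b2; have := submodsD (sB X) b1 b2; rewrite subrKA. Qed.

Lemma bd_sym X (j : int) (x y : X j) : bd (x - y) -> bd (y - x).
Proof. by rewrite -[x - y]opprB => /(submodsN (sB X)); rewrite opprK. Qed.

Lemma coh_rel_htp (j : int) X Y (f g : chain_map X Y) (x : X j) (y : Y j) :
  homotopic f g -> coh_rel f x y -> coh_rel g x y.
Proof.
have [i ej] := ex_pred j; subst j => fg [cx cy b]; split=> //.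
apply: bd_trans b _; have [z ->] := htp_cocycle fg cx.
by rewrite addKl; apply: Bd.
Qed.

Definition coh_rrep (j : int) : rrep K.
Proof.
apply: (@RRep R K (fun X : cplx R => X j) (fun X Y f => @coh_rel j X Y f)) => /=.
- move=> X Y f g x y fg; split; apply: coh_rel_htp => //; exact: htp_sym.
- move=> X Y Z g f x z; split=> [[cx cz b]|[y [[cx cy b] [_ cz b']]]].
    exists (f j x); split; split=> //; try exact: cm_coc.
    by rewrite subrr; apply: (submods0 (sB Y)).
  split=> //; apply: bd_trans b' _; have := cm_bd g b.
  by rewrite /= !addE.
- by move=> X x x' [cx cx' b]; split=> //; apply: bd_sym.
- move=> X Y f x' x y [cx' cx b] [_ cy b']; split=> //; apply: bd_trans b' _.
  by have := cm_bd f b; rewrite !addE.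
- move=> X Y f x y y' [cx cy b] [_ cy' b']; split=> //; exact: bd_trans b' b.
- by move=> X Y f x y [cx _ _]; split=> //; rewrite subrr; apply: (submods0 (sB X)).
- by move=> X Y f x y [_ cy _]; split=> //; rewrite subrr; apply: (submods0 (sB Y)).
Defined.

Lemma coh_qis_invertible (j : int) X Y (f : chain_map X Y) : qis f ->
  @invertible R K (coh_rrep j) X Y f.
Proof.
have [i ej] := ex_pred j; subst j => -[inj srj].
have injb (x : X (i + 1)) : coc x -> bd (f _ x) -> bd x.
  by move=> cx /bdP [y fx]; have [x' ->] := inj _ _ _ cx fx; apply: Bd.
split=> /=.
- move=> x [cx _ _]; exists (f _ x); split=> //; first exact: cm_coc.
  by rewrite subrr; apply: (submods0 (sB Y)).
- move=> y [cy _ _]; have [x [y' [cx ->]]] := srj _ _ cy.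
  exists x; split=> //; first by rewrite /coc diffD -cm_diff cx cm0 diffK addr0.
  by rewrite addKl; apply: Bd.
- move=> x x' y [cx cy b] [cx' _ b']; split=> //; apply: injb.
    exact: (submodsB (@submods_coc _ X)).
  by rewrite !addE; apply: bd_trans (bd_sym b') b.
- move=> x y y' [cx cy b] [_ cy' b']; split=> //.
  by apply: bd_trans b' (bd_sym b).
Qed.

Lemma coh_inv (j : int) (X Y : K) (s : Defs.hom X Y) :
  has_cone_in (T := K) (@acyclic R) s -> invertible (coh_rrep j) s.
Proof.
move=> /has_cone_acyclic; apply: conj_invertible => X1 Y1 u /cone_qis.
exact: coh_qis_invertible.
Qed.

Definition coh_loc (j : int) : rrep D := loc_rrep (@coh_inv j).

Lemma coh_loc_linear (j : int) (X Y : D) (p : Defs.hom X Y) a x y x' y' :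
  rrel (coh_loc j) p x y -> rrel (coh_loc j) p x' y' ->
  rrel (coh_loc j) p (a *: x + x') (a *: y + y').
Proof.
have lin (U V : K) (f : chain_map U V) (b : R) (u u' : U j) (v v' : V j) :
    coh_rel f u v -> coh_rel f u' v' -> coh_rel f (b *: u + u') (b *: v + v').
  move=> [cu cv bu] [cu' cv' bu']; split; try exact: (submodsP (@submods_coc _ _)).
  have := submodsP (sB V) b bu bu'; congr (bd _).
  by rewrite linearP scalerBr; zmod.
elim: p x y x' y' => {X Y} [X Y f|X Y s w|X Y Z p IHp q IHq] x y x' y' /=.
- exact: lin.
- exact: lin.
move=> [z [qxz pzy]] [z' [qxz' pzy']]; exists (a *: z + z').
by split; [apply: IHq | apply: IHp].
Qed.

(** An isomorphism of the derived category is a zigzag through arbitrary complexes,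
    but it still acts on cohomology by a linear bijection, which transports
    generators. *)
Lemma fgH_iso X Y : @isomorphic R D X Y -> fgH X -> fgH Y.
Proof.
move=> [p Ip] [L [cL gL]].
have Ij j := iso_invertible (coh_loc j) Ip.
have pe j (x : X j) : coc x -> exists y, rrel (coh_loc j) p x y.
  move=> cx; apply: (inv_totl (Ij j)); split=> //.
  by rewrite subrr; apply: (submods0 (sB X)).
have p0 j : rrel (coh_loc j) p (0 : X j) (0 : Y j).
  have [|y p0y] := pe j 0; first exact: (submods0 (@submods_coc _ _)).
  have := coh_loc_linear (-1) p0y p0y.
  by rewrite !scaleN1r !addNr.
pose tr (P : forall j : int, Y j -> Prop) (j : int) (x : X j) :=
  exists y, rrel (coh_loc j) p x y /\ P j y.
have [L' [cL' LL']] : exists L' : hseq Y, allL (@coc _ Y) L' /\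
    forall P : forall j : int, Y j -> Prop, allL P L' -> allL (tr P) L.
  elim: L cL {gL} => [_|[j x] L IH [/= cx /IH [L' [cL' LL']]]]; first by exists [::].
  have [y pxy] := pe _ _ cx; exists (homog y :: L'); split.
    by split=> //; case: (rel_cod pxy).
  by move=> P [/= Py /LL' PL]; split=> //; exists y.
exists L'; split=> // P sP Pbd /LL' PL j y cy.
have [x pxy] : exists x, rrel (coh_loc j) p x y.
  apply: (inv_totr (Ij j)); split=> //.
  by rewrite subrr; apply: (submods0 (sB Y)).
have cx : coc x by case: (rel_dom pxy).
have [||y' [pxy' Py']] := gL (tr P) _ _ PL j x cx.
- move=> {x y cy pxy cx}j; split; first by exists 0; split; [exact: p0 | exact: (submods0 sP)].
  move=> a x x' [y [pxy Py]] [y' [pxy' Py']]; exists (a *: y + y').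
  by split; [apply: coh_loc_linear | apply: (submodsP sP)].
- move=> k z bz; exists 0; split; last exact: (submods0 sP).
  apply: rel_idl (p0 k); split; [exact: bd_coc | exact: (submods0 (@submods_coc _ _)) |].
  by rewrite sub0r; apply: (submodsN (sB X)).
have [_ _ b] := inv_funr (Ij j) pxy' pxy.
by rewrite -[y](subrK y'); apply: (submodsD sP) => //; apply: Pbd.
Qed.

Lemma fgH_tri_stable : noetherian R -> tri_stable (@fgH R).
Proof.
move=> noeth; split.
- exact: fgH_acyclic.
- move=> X Y f /qis_iso XY; split; apply: fgH_iso => //.
  apply: isomorphic_sym => //; exact: (verdier_laws (@acyclic R : K -> Prop) (homotopy_laws R)).
- exact: fgH_shift.
- by move=> X Y f; apply: fgH_cone.
Qed.

(** The objects that are annihilated, as complexes. With finite generation, the cones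
    that occur are objects of the subcategory in which the quotient is taken. *)
Definition perf_fg X : Prop := thick (T := D) (ring_cplx R) X /\ fgH X.

Lemma perf_fg_tri_stable : noetherian R -> tri_stable perf_fg.
Proof.
move=> noeth; have [a1 q1 s1 c1] := thick_tri_stable (@thick_is_thick R (ring_cplx R)).
have [a2 q2 s2 c2] := fgH_tri_stable noeth; split.
- by move=> X aX; split; [apply: a1 | apply: a2].
- by move=> X Y f qf; rewrite /perf_fg; split=> -[h1 h2]; split;
    [apply/(q1 _ _ _ qf) | apply/(q2 _ _ _ qf) | apply/(q1 _ _ _ qf) | apply/(q2 _ _ _ qf)].
- move=> X; split=> -[h1 h2]; split.
  + exact: (s1 X).1.
  + exact: (s2 X).1.
  + exact: (s1 X).2.
  + exact: (s2 X).2.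
- by move=> X Y f [h1 h2] [h3 h4]; split; [apply: c1 | apply: c2].
Qed.

Lemma perf_fg_iso X Y : @isomorphic R D X Y -> perf_fg X -> perf_fg Y.
Proof.
move=> XY [tX fX]; split; last exact: fgH_iso XY fX.
exact: (thick_iso (@thick_is_thick R (ring_cplx R)) XY tX).
Qed.

End DerivedCohomology.

(** * The ring in an arbitrary degree *)

Section Concentrated.
Variable R : comNzRingType.
Implicit Types X Y F : cplx R.

(** [F] is a copy of [R] in degree [i]. A predicate rather than a complex, since the
    shift of such a complex is again one, but only up to isomorphism equal to the
    chosen model. *)
Record conc (i : int) F := Conc {
  conc_in : {linear R^o -> F i};
  conc_out : {linear F i -> R^o};
  conc_inK : cancel conc_in conc_out;
  conc_outK : cancel conc_out conc_in;
  conc_ne : forall (j : int) (x : F j), i != j -> x = 0 }.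

Definition conc_mod (i j : int) : lmodType R :=
  if j == i then (R^o : lmodType R) else ('rV[R]_0 : lmodType R).

Program Definition conc_cplx (i : int) : cplx R := @Cplx R (conc_mod i) (fun j : int => \0) _.
Next Obligation. by []. Qed.

Lemma conc_cplxP (i : int) : inhabited (conc i (conc_cplx i)).
Proof.
have triv (b : bool) : b = false ->
    forall x : (if b then (R^o : lmodType R) else ('rV[R]_0 : lmodType R)), x = 0.
  by move=> -> x; apply/rowP => -[].
have ne (j : int) (x : conc_cplx i j) : i != j -> x = 0.
  by rewrite eq_sym => /negbTE ij; apply: triv.
suff [f [g [fK gK]]] : 
    exists (f : {linear R^o -> conc_cplx i i}) (g : {linear conc_cplx i i -> R^o}),
    cancel f g /\ cancel g f by exists; exact: Conc fK gK ne.
rewrite /= /conc_mod eqxx; by exists idfun, idfun.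
Qed.

Lemma conc_ring : conc_cplx 0 = ring_cplx R.
Proof. by rewrite /ring_cplx /conc_cplx; congr Cplx; apply: Prop_irrelevance. Qed.

Lemma conc_coc (i : int) F (x : F i) : conc i F -> coc x.
Proof. by move=> cF; apply: (conc_ne cF); rewrite -subr_eq0 opprD addNKr oppr_eq0 oner_eq0. Qed.

(** [delta] carries out the case distinction on degrees: the map is
    x |-> x * z in degree [i] and zero elsewhere. *)
Lemma conc_map (i : int) F X (z : X i) : forall cF : conc i F, coc z ->
  exists f : chain_map F X, forall a, f i (conc_in cF a) = a *: z.
Proof.
move=> cF cz.
pose f0 (j : int) (x : F j) : X j := delta (conc_out cF (delta x i) *: z) j.
have lin (j : int) : linear (@f0 j).
  move=> a x y; rewrite /f0 deltaP linearP scalerDl -scalerA.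
  by rewrite -deltaP.
have dz (w : X i) : coc w -> forall j : int, diff X j (delta w j) = 0.
  by move=> cw j; apply: delta_coc.
have ch (j : int) x : mk_linear (lin (j + 1)) (diff F j x) = diff X j (mk_linear (lin j) x).
  rewrite /= /f0 dz; last by rewrite /coc linearZ /= cz scaler0.
  have -> : diff F j x = 0.
    case: (eqVneq i (j + 1)) => [e|ne]; last exact: (conc_ne cF).
    rewrite [x](conc_ne cF) ?diff0 // e addrC -subr_eq0 addrK oner_eq0 //.
  by rewrite delta0 linear0 scale0r delta0.
by exists (ChainMap ch) => a; rewrite /= /f0 !delta_id conc_inK.
Qed.

Lemma conc_qis (i : int) F F' : conc i F -> conc i F' -> exists f : chain_map F F', qis f.
Proof.
move=> cF cF'; have [f fE] := conc_map cF (conc_coc (conc_in cF' 1) cF').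
have {}fE a : f i (conc_in cF a) = conc_in cF' a by rewrite fE -linearZ /= [a%:A]mulr1.
exists f; apply: qis_bij => j x; case: (eqVneq i j) => [e|ne].
- case: _ / e in x *; rewrite -[x](conc_outK cF) fE => e.
  by rewrite -(conc_inK cF' (conc_out cF x)) e !linear0.
- by move=> _; apply: (conc_ne cF).
- case: _ / e in x *; exists (conc_in cF (conc_out cF' x)).
  by rewrite fE conc_outK.
- by exists 0; rewrite cm0 (conc_ne cF' x ne).
Qed.

Lemma conc_shift (i : int) F : conc (i + 1) F -> conc i (cplx_shift F).
Proof.
case=> f g fK gK ne; apply: (@Conc i (cplx_shift F) f g fK gK) => j x ij.
by apply: ne; rewrite (inj_eq (addIr 1)).
Qed.

(** Shifting reaches all degrees from degree 0, where the complex is [R] itself. *)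
Lemma conc_tri_stable (N : cplx R -> Prop) (i : int) :
  tri_stable N -> N (ring_cplx R) -> N (conc_cplx i).
Proof.
move=> NP N0.
have step (j : int) : N (conc_cplx j) <-> N (conc_cplx (j + 1)).
  have [[c] [c']] := (conc_cplxP j, conc_cplxP (j + 1)).
  have [f qf] := conc_qis c (conc_shift c').
  split=> [/(ts_qis NP qf) H|H]; first by apply/(ts_shift NP).
  by apply/(ts_qis NP qf); apply: (ts_shift NP _).1.
have N0' : N (conc_cplx 0) by rewrite conc_ring.
elim: i => [//|n IH|n IH].
  by move/step: IH; rewrite addrC -intS.
by apply/step; move: IH; rewrite -[- _]/(- _); congr (N (conc_cplx _)); rewrite intS; zmod.
Qed.

Lemma fgH_conc (i : int) F : conc i F -> fgH F.
Proof.
move=> cF; exists [:: homog (conc_in cF 1)]; split; first by split=> //; apply: conc_coc.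
move=> P sP _ [/= P1 _] j x _; case: (eqVneq i j) => [e|ne]; last first.
  by rewrite (conc_ne cF x ne); apply: (submods0 sP).
case: _ / e in x *.
have -> : x = conc_out cF x *: conc_in cF 1 by rewrite -linearZ /= [_%:A]mulr1 conc_outK.
exact: (submodsZ sP).
Qed.

Lemma perf_fg_conc (i : int) : noetherian R -> perf_fg (conc_cplx i).
Proof.
move=> noeth; apply: conc_tri_stable; first exact: perf_fg_tri_stable.
split; first by move=> P _.
by have [c] := conc_cplxP 0; rewrite -conc_ring; apply: fgH_conc c.
Qed.

End Concentrated.

(** * Inverting the shift *)

Section InverseShift.
Variable R : comNzRingType.
Implicit Types X Y Z V W : cplx R.

(** Transport along an equality of degrees, as a linear map. *)
Definition castm X (i j : int) (e : i = j) : {linear X i -> X j} :=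
  match e in _ = j return {linear X i -> X j} with erefl => idfun end.

Lemma castm_diff X (i j : int) (e : i = j) (e' : i + 1 = j + 1) (x : X i) :
  diff X j (castm X e x) = castm X e' (diff X i x).
Proof. by case: _ / e in e' *; rewrite (eq_irrelevance e' (erefl _)). Qed.

Lemma castm_comp X (i j k : int) (e : i = j) (e' : j = k) (e'' : i = k) (x : X i) :
  castm X e' (castm X e x) = castm X e'' x.
Proof. by case: _ / e' in e'' *; case: _ / e in e'' *; rewrite (eq_irrelevance e'' (erefl _)). Qed.

Lemma castm_bij X (i j : int) (e : i = j) (y : X j) : exists x, castm X e x = y.
Proof. by case: _ / e in y *; exists y. Qed.

Lemma castm_inj X (i j : int) (e : i = j) (x : X i) : castm X e x = 0 -> x = 0.
Proof. by case: _ / e. Qed.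

Lemma pred_succ (i : int) : i - 1 + 1 = i + 1 - 1.
Proof. by rewrite subrK addrK. Qed.

Program Definition unshift X : cplx R :=
  @Cplx R (fun i : int => X (i - 1))
    (fun i : int => \- (castm X (pred_succ i) \o diff X (i - 1))) _.
Next Obligation.
move=> X i x; rewrite /= diffN linearN opprK.
by rewrite (castm_diff _ (congr1 (+%R^~ 1) (pred_succ i))) diffK !linear0.
Qed.

Program Definition unshift_map X : chain_map X (cplx_shift (unshift X)) :=
  @ChainMap R _ _ (fun i : int => castm X (esym (addrK 1 i))) _.
Next Obligation.
move=> X i x; rewrite /= opprK.
rewrite (castm_diff _ (congr1 (+%R^~ 1) (esym (addrK 1 i)))).
by rewrite (castm_comp _ _ (esym (addrK 1 (i + 1)))).
Qed.

Lemma qis_unshift X : qis (unshift_map X).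
Proof.
by apply: qis_bij => i x /=; [apply: castm_inj | apply: castm_bij].
Qed.

Lemma cm_unshift X Y (a : chain_map (cplx_shift X) (cplx_shift Y)) :
  exists a0 : chain_map X Y, forall (i : int) x, a0 (i + 1) x = a i x.
Proof.
pose F := unsh (P := fun j => {linear X j -> Y j}) (fun i => a i).
have FE (i : int) : F (i + 1) = a i by exact: unshE.
have ch (j : int) x : F (j + 1) (diff X j x) = diff Y j (F j x).
  move: j x; apply: all_succ => i x; rewrite !FE.
  have := cm_diff a x; rewrite /= [a _ (- _)]linearN => /oppr_inj.
  by [].
by exists (ChainMap ch) => i x /=; rewrite FE.
Qed.

Lemma htp_unshift X Y (f g : chain_map X Y) :
  homotopic (cm_shift f) (cm_shift g) -> homotopic f g.
Proof.
move=> [h H]; exists (unsh (P := fun j => {linear X (j + 1) -> Y j}) (fun i => \- h i)).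
apply: all_succ => i x; rewrite !unshE; have := H i x; rewrite /= => ->.
by rewrite linearN !linearN.
Qed.

Variables (N : cplx R -> Prop) (NP : tri_stable N).

Lemma wk_ext X Y (f g : chain_map X Y) : (forall (i : int) x, f i x = g i x) -> wk N f -> wk N g.
Proof.
move=> fg.
have ch (i : int) (x : cone f i) :
    (idfun : {linear cone f (i + 1) -> cone g (i + 1)}) (diff (cone f) i x) = diff (cone g) i x.
  by pairs; rewrite ?fg.
have q : qis (@ChainMap R (cone f) (cone g) (fun i => idfun) ch).
  by apply: qis_bij => [//|i y]; exists y.
by move/(ts_qis NP q).
Qed.

(** A weak map out of [X[1]] is, up to quasi-isomorphism of its target, the shift of a
    weak map out of [X]. *)
Lemma cplx_kills_unshift r X : cplx_kills NP r (cplx_shift X) -> cplx_kills NP r X.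
Proof.
move=> /cplx_killsP [W [a [Na a0]]]; apply/cplx_killsP.
have [b bE] := cm_unshift (cm_comp (unshift_map W) a).
exists (unshift W), b; split.
  apply/(wk_shift NP); apply: (@wk_ext _ _ (cm_comp (unshift_map W) a)).
    by move=> i x; rewrite /= bE.
  by apply: (wk_comp NP) => //; apply: (wk_qis NP); apply: qis_unshift.
apply: htp_unshift; apply: (htp_trans (g := cm_comp (unshift_map W) (cm_scale r a))).
  apply: (htp_trans (g := cm_scale r (cm_comp (unshift_map W) a))).
    by apply: htp_ext => i x; rewrite /= bE.
  exact/htp_sym/htp_compZ.
apply: htp_trans (htp_compl _ a0) _.
by apply: htp_ext => i x; apply: linear0.
Qed.

End InverseShift.

(** * Subcomplexes *)

Section SubModule.
Variables (R : comNzRingType) (V : lmodType R) (P : V -> Prop).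

Definition is_submod := P 0 /\ forall (a : R) x y, P x -> P y -> P (a *: x + y).

Definition submod_pred : {pred V} := fun x => `[< P x >].

Lemma submod_pred_closed : is_submod -> subsemimod_closed submod_pred.
Proof.
move=> [P0 PL]; split; first split.
- exact/asboolP.
- move=> x y /asboolP Px /asboolP Py; apply/asboolP.
  by rewrite -[x]scale1r; apply: PL.
- move=> a x /asboolP Px; apply/asboolP.
  by rewrite -[_ *: _]addr0; apply: PL.
Qed.

(** The proof is an argument so that the module structure can depend on it. *)
Definition submod & is_submod := {x : V | submod_pred x}.

Variable sP : is_submod.
HB.instance Definition _ := SubChoice.on (submod sP).
HB.instance Definition _ :=
  GRing.SubChoice_isSubLmodule.Build R V submod_pred (submod sP) (submod_pred_closed sP).

Definition submod_in (x : V) (Px : P x) : submod sP := exist _ x (asboolT Px).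

Lemma submod_inP (x : submod sP) : P (val x).
Proof. exact/asboolP/(valP x). Qed.

Section Corestriction.
Variables (U : lmodType R) (f : {linear U -> V}) (Pf : forall u, P (f u)).

Fact corestr_linear : linear (fun u => submod_in (Pf u)).
Proof. by move=> a x y; apply: val_inj; rewrite [RHS]linearP /= linearP. Qed.

Definition corestr : {linear U -> submod sP} := mk_linear corestr_linear.

End Corestriction.
End SubModule.

Section SubComplex.
Variable R : comNzRingType.
Implicit Types X Y : cplx R.

Record stable X (P : forall i : int, X i -> Prop) : Prop := Stable {
  st_sub : submods P;
  st_diff : forall (i : int) x, P i x -> P (i + 1) (diff X i x) }.

Section Def.
Variables (X : cplx R) (P : forall i : int, X i -> Prop) (sP : stable P).

Let mod (i : int) : lmodType R := submod (st_sub sP i).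
Let vl (i : int) : {linear mod i -> X i} := val.

Fact subcplx_diffP (i : int) (x : mod i) : P ((diff X i \o vl i) x).
Proof. exact: (st_diff sP (submod_inP x)). Qed.

Program Definition subcplx : cplx R :=
  @Cplx R mod (fun i : int => corestr (st_sub sP (i + 1)) (@subcplx_diffP i)) _.
Next Obligation. by move=> i x; apply: val_inj; rewrite /= diffK. Qed.

Program Definition sub_val : chain_map subcplx X := @ChainMap R subcplx X vl _.
Next Obligation. by []. Qed.

Lemma sub_val_inj (i : int) : injective (sub_val i).
Proof. exact: val_inj. Qed.

Lemma sub_valP (i : int) (x : subcplx i) : P (sub_val i x).
Proof. exact: submod_inP. Qed.

Lemma sub_val_surj (i : int) (x : X i) : P x -> exists y, sub_val i y = x.
Proof. by move=> Px; exists (submod_in (st_sub sP i) Px). Qed.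

End Def.

Lemma subcplx_map X Y (P : forall i : int, X i -> Prop) (Q : forall i : int, Y i -> Prop)
    (sP : stable P) (sQ : stable Q) (f : chain_map X Y) :
  (forall (i : int) x, P i x -> Q i (f i x)) ->
  exists g : chain_map (subcplx sP) (subcplx sQ),
    forall (i : int) x, sub_val sQ i (g i x) = f i (sub_val sP i x).
Proof.
move=> PQ.
have Qf (i : int) (x : subcplx sP i) : Q i ((f i \o sub_val sP i) x).
  exact: (PQ _ _ (sub_valP x)).
pose F (i : int) := corestr (st_sub sQ i) (Qf i).
have ch (i : int) x : F (i + 1) (diff (subcplx sP) i x) = diff (subcplx sQ) i (F i x).
  by apply: val_inj; rewrite /= cm_diff.
by exists (@ChainMap R (subcplx sP) (subcplx sQ) F ch).
Qed.

End SubComplex.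

(** * Bounded complexes whose cohomology is killed by a scalar *)

Section Embedded.
Variables (R : comNzRingType) (X A B : cplx R) (g : chain_map A B).
Variables (u : chain_map A X) (v : chain_map B X).
Hypotheses (u_inj : forall i : int, injective (u i)) (v_inj : forall i : int, injective (v i)).
Hypothesis vg : forall (i : int) x, v i (g i x) = u i x.
Variables P Q : forall i : int, X i -> Prop.
Hypothesis uP : forall (i : int) x, P x <-> exists a, u i a = x.
Hypothesis vQ : forall (i : int) x, Q x <-> exists b, v i b = x.

(** When [A] and [B] are subcomplexes of [X] with members [P] and [Q], that the
    inclusion is a quasi-isomorphism is a statement about elements of [X]. *)
Lemma qis_embedded :
  (forall (i : int) y, Q y -> P (diff X i y) ->
     exists2 y', P y' & diff X i y = diff X i y') ->
  (forall (i : int) (y : X (i + 1)), Q y -> coc y ->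
     exists x (y' : X i), [/\ P x, Q y' & y = x + diff X i y']) ->
  qis g.
Proof.
move=> inj srj; split=> [i a b da gab|i b db].
  have ua : u _ a = diff X i (v i b) by rewrite -vg gab cm_diff.
  have [||y /uP [a' <-] e] := inj i (v i b).
  - by apply/vQ; exists b.
  - by apply/uP; exists a.
  by exists a'; apply: u_inj; rewrite cm_diff ua.
have [||x [y [/uP [a ua] /vQ [b' vb'] e]]] := srj i (v _ b).
- by apply/vQ; exists b.
- by rewrite /coc -cm_diff db cm0.
exists a, b'; split; last by apply: v_inj; rewrite cmD vg cm_diff ua vb'.
apply: u_inj; rewrite cm0 cm_diff ua.
have -> : x = v _ b - diff X i y by rewrite e; zmod.
by rewrite diffD diffN diffK -cm_diff db cm0 subrr.
Qed.

End Embedded.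

Section Truncation.
Variables (R : comNzRingType) (X : cplx R).
Implicit Types b i : int.

(** Everything below degree [b], only [Q] in degree [b], nothing above. *)
Definition trunc (Q : forall i : int, X i -> Prop) b i (x : X i) : Prop :=
  (b < i -> x = 0) /\ (i = b -> Q i x).

Lemma trunc_stable (Q : forall i : int, X i -> Prop) b :
  submods Q -> (forall i x, Q i x -> coc x) -> (forall i x, bd x -> Q i x) ->
  stable (trunc Q b).
Proof.
move=> sQ Qc bQ; split.
  move=> i; split=> [|a x y [x0 Qx] [y0 Qy]].
    by split=> // _; apply: (submods0 sQ).
  split=> [bi|ib]; first by rewrite x0 // y0 // scaler0 addr0.
  by apply: (submodsP sQ); [apply: Qx | apply: Qy].
move=> i x [x0 Qx]; split=> [bi|ib]; last exact/bQ/Bd.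
case: (ltgtP b i) => [lt_bi|gt_bi|eq_bi].
- by rewrite x0 ?diff0.
- by lia.
- by apply: Qc; apply: Qx.
Qed.

Lemma coc_stable b : stable (trunc (@coc R X) b).
Proof. by apply: trunc_stable => //; [exact: submods_coc | move=> i x; apply: bd_coc]. Qed.

Lemma bd_stable b : stable (trunc (@bd R X) b).
Proof. by apply: trunc_stable => //; [exact: submods_bd | move=> i x; apply: bd_coc]. Qed.

(** [tau_le b] has the cohomology of [X] in degrees at most [b], and [tau_bd b] has
    it in degrees below [b] only. *)
Definition tau_le b := subcplx (coc_stable b).
Definition tau_bd b := subcplx (bd_stable b).

Lemma subcplxE (P : forall i : int, X i -> Prop) (sP : stable P) i (x : X i) :
  P i x <-> exists y, sub_val sP i y = x.
Proof. by split=> [/(sub_val_surj sP)//|[y <-]]; apply: sub_valP. Qed.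

Lemma qis_tau_bd b : exists f : chain_map (tau_le b) (tau_bd (b + 1)), qis f.
Proof.
have [i x [x0 cx]|f fE] := subcplx_map (coc_stable b) (bd_stable (b + 1)) (f := cm_id X).
  split=> [bi|ib]; first by apply: x0; lia.
  by rewrite /= x0 ?ib; [apply: (submods0 (@submods_bd R X)) | lia].
exists f; apply: (qis_embedded (@sub_val_inj _ _ _ _) (@sub_val_inj _ _ _ _) fE
  (subcplxE (coc_stable b)) (subcplxE (bd_stable (b + 1)))).
  move=> i y [y0 _] [dy0 _]; case: (ltrP b (i + 1)) => [bi|ib].
    exists 0; last by rewrite dy0 ?diff0.
    exact: (submods0 (st_sub (coc_stable b))).
  by exists y => //; split=> [bi|eb]; [lia | rewrite /coc -/(diff _ _ _); lia].
move=> i y [y0 by0] cy; case: (ltgtP (i + 1) (b + 1)) => [lt_ib|gt_ib|e].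
- exists y, 0; rewrite diff0 addr0; split=> //; last exact: (submods0 (st_sub (bd_stable _))).
  by split=> [|_//]; lia.
- exists 0, 0; rewrite y0 ?diff0 ?addr0 //; split=> //.
    exact: (submods0 (st_sub (coc_stable _))).
  exact: (submods0 (st_sub (bd_stable _))).
have /bdP [w ->] := by0 e; exists 0, w; rewrite add0r; split=> //.
  exact: (submods0 (st_sub (coc_stable _))).
by split=> [|]; lia.
Qed.

Lemma acyclic_tau_le b : (forall i x, i <= b -> coc x -> bd (x : X i)) -> acyclic (tau_le b).
Proof.
move=> H i x /(congr1 (sub_val _ _)); rewrite cm_diff cm0 => cx.
case: (lerP (i + 1) b) => [ib|bi].
  have /bdP [y ey] := H _ _ ib cx.
  have [|z ez] := sub_val_surj (coc_stable b) (x := y); first by split; lia.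
  by exists z; apply: (@sub_val_inj _ _ _ (coc_stable b)); rewrite cm_diff ez.
exists 0; rewrite diff0; apply: (@sub_val_inj _ _ _ (coc_stable b)).
by rewrite cm0 (sub_valP x).1.
Qed.

Lemma qis_tau_le b : (forall i x, b < i -> coc x -> bd (x : X i)) ->
  qis (sub_val (coc_stable b)).
Proof.
move=> H; pose v := sub_val (coc_stable b).
apply: (@qis_embedded R X (tau_le b) X v v (cm_id X) _ _ _
  (trunc (@coc R X) b) (fun _ _ => True)) => //.
- exact: sub_val_inj.
- by move=> i x y.
- exact: (subcplxE (coc_stable b)).
- by move=> i x; split=> // _; exists x.
- move=> i y _ [dy0 _]; case: (ltrP b (i + 1)) => [bi|ib].
    exists 0; last by rewrite dy0 ?diff0.
    exact: (submods0 (st_sub (coc_stable b))).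
  by exists y => //; split; lia.
move=> i y _ cy; case: (lerP (i + 1) b) => [ib|bi].
  by exists y, 0; rewrite diff0 addr0; split=> //; split=> [|_ //]; lia.
have /bdP [w ->] := H _ _ bi cy; exists 0, w; rewrite add0r; split=> //.
exact: (submods0 (st_sub (coc_stable _))).
Qed.

Variables (N : cplx R -> Prop) (NP : tri_stable N) (r : R).
Hypothesis rH : forall i (x : X i), coc x -> bd (r *: x).

(** Multiplication by [r] sends [tau_le b] into [tau_bd b], which is
    quasi-isomorphic to the next smaller truncation. *)
Lemma kills_tau_step s b :
  cplx_kills NP s (tau_le b) -> cplx_kills NP (s * r) (tau_le (b + 1)).
Proof.
have [f qf] := qis_tau_bd b.
move/(cplx_kills_wk NP s (wk_qis NP qf)).
have [i x [x0 cx]|g gE] := subcplx_map (coc_stable (b + 1)) (bd_stable (b + 1))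
    (f := cm_scale r (cm_id X)).
  by split=> [bi|ib]; [rewrite /= x0 ?scaler0 | apply/rH/cx].
have [i x [x0 bx]|h hE] := subcplx_map (bd_stable (b + 1)) (coc_stable (b + 1)) (f := cm_id X).
  by split=> [bi|ib]; [apply: x0 | apply/bd_coc/bx].
apply: (cplx_kills_factor (f := g) (g := h)); apply: htp_ext => i x.
apply: (@sub_val_inj _ _ _ (coc_stable (b + 1))).
rewrite -[LHS]/(sub_val _ i (h i (g i x))) hE -[LHS]/(sub_val _ i (g i x)) gE.
by rewrite [RHS]linearZ.
Qed.

(** Starting from an acyclic truncation, each of the [2 n + 1] degrees from [- n] to
    [n] costs a factor [r]. *)
Lemma kills_torsion (n : nat) :
  (forall i (x : X i), (n < `|i|)%N -> coc x -> bd x) ->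
  exists m : nat, cplx_kills NP (r ^+ m) X.
Proof.
move=> H; exists (n.*2.+1)%N.
have K (m : nat) : cplx_kills NP (r ^+ m) (tau_le (m%:Z - n.+1%:Z)).
  elim: m => [|m IH].
    apply/cplx_kills_mem/(ts_acyclic NP)/acyclic_tau_le => i x i0 cx.
    by apply: H => //; lia.
  rewrite exprSr; have -> : m.+1%:Z - n.+1%:Z = m%:Z - n.+1%:Z + 1 by lia.
  exact: kills_tau_step.
have q : qis (sub_val (coc_stable n%:Z)).
  by apply: qis_tau_le => i x ni cx; apply: H => //; lia.
apply/(cplx_kills_wk NP _ (wk_qis NP q)).
have -> : n%:Z = n.*2.+1%:Z - n.+1%:Z by lia.
exact: K.
Qed.

End Truncation.

(** * Finitely generated cohomology over a domain *)

Section TorsionFree.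
Variables (R : idomainType) (N : cplx R -> Prop) (NP : tri_stable N).
Hypothesis N_conc : forall i : int, N (conc_cplx R i).

Definition torsion (X : cplx R) (i : int) (x : X i) : Prop :=
  coc x /\ exists r, r != 0 /\ bd (r *: x).

Lemma allL_torsion (X : cplx R) (T : hseq X) : allL (@torsion X) T ->
  exists r, r != 0 /\ allL (fun i x => bd (r *: x)) T.
Proof.
elim: T => [|u T IH] /=; first by exists 1; rewrite oner_neq0.
move=> [[_ [r [r0 bu]]] /IH [s [s0 bT]]]; exists (r * s); split; first by rewrite mulf_neq0.
split; first by rewrite mulrC -scalerA; apply: (submodsZ (@submods_bd R X)).
apply: allL_impl bT => i x bx; rewrite -scalerA.
exact: (submodsZ (@submods_bd R X)).
Qed.

Lemma allL_bound (X : cplx R) (T : hseq X) :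
  exists n : nat, allL (fun i (_ : X i) => (`|i| <= n)%N) T.
Proof.
elim: T => [|u T [n Hn]] /=; first by exists 0%N.
exists (maxn `|tag u|%N n); split; first exact: leq_maxl.
by apply: allL_impl Hn => i x /leq_trans; apply; apply: leq_maxr.
Qed.

Lemma kills_all_torsion (X : cplx R) (T : hseq X) :
  allL (@torsion X) T -> gen T -> exists r, r != 0 /\ cplx_kills NP r X.
Proof.
move=> tT gT; have [r [r0 rT]] := allL_torsion tT; have [n nT] := allL_bound T.
have sB := @submods_bd R X.
have [||m km] := @kills_torsion R X N NP r _ n.
- apply: (gT (fun i x => bd (r *: x))) => //; last first.
    by move=> i x bx; apply: (submodsZ sB).
  move=> i; split=> [|a x y bx bY]; first by rewrite scaler0; apply: (submods0 sB).
  by rewrite scalerDr scalerA mulrC -scalerA; apply: (submodsP sB).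
- move=> i x ni cx; move: i x cx ni; apply: (gT (fun i x => (n < `|i|)%N -> bd x)) => //.
    move=> i; split=> [_|a x y bx bY ni]; first exact: (submods0 sB).
    by apply: (submodsP sB); [apply: bx | apply: bY].
  by apply: allL_impl nT => i x /= le_in; rewrite ltnNge le_in.
by exists (r ^+ m); rewrite expf_neq0.
Qed.

Definition hmap (X Y : cplx R) (f : chain_map X Y) (u : helt X) : helt Y :=
  homog (f (tag u) (tagged u)).

Lemma allL_hmap (X Y : cplx R) (f : chain_map X Y) (P : forall i : int, Y i -> Prop) (L : hseq X) :
  allL P (map (hmap f) L) <-> allL (fun i x => P i (f i x)) L.
Proof. by elim: L => //= u L ->. Qed.

(** Coning off a nontorsion class [z] kills it and creates no new cohomology,
    since no nonzero multiple of [z] bounds. *)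
Lemma gen_cone (X : cplx R) (i : int) (z : X i) (L : hseq X) F (cF : conc i F)
    (f : chain_map F X) :
  (forall a, f i (conc_in cF a) = a *: z) -> coc z -> ~ torsion z ->
  gen (homog z :: L) -> gen (map (hmap (cone_in f)) L).
Proof.
have [k ei] := ex_pred i; subst i.
move=> fE cz ntz gL P sP Pbd /allL_hmap PL j [x' x] dxx.
have [dx' dx] : - diff F _ x' = 0 /\ f _ x' + diff X _ x = 0 by case: dxx.
have x'0 : x' = 0.
  case: (eqVneq k j) => [e|ne]; last by apply: (conc_ne cF); rewrite (inj_eq (addIr 1)).
  subst j; rewrite -(conc_outK cF x'); set a := conc_out cF x'.
  have [->|a0] := eqVneq a 0; first exact: linear0.
  case: ntz; split=> //; exists a; split=> //.
  rewrite -fE (conc_outK cF); move/addr0P: dx => ->.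
  by apply: (submodsN (@submods_bd R X)); apply: Bd.
rewrite x'0 cm0 add0r in dx *.
apply: (gL (fun i x => P i (cone_in f i x))) => //.
- move=> l; split=> [|a v w Pv Pw]; first by rewrite cm0; apply: (submods0 sP).
  by rewrite linearP; apply: (submodsP sP).
- by move=> l v /(cm_bd (cone_in f)); apply: Pbd.
split=> //=; apply: Pbd; apply/bdP; exists (conc_in cF 1, 0).
by apply: pair_ext; rewrite /= ?fE ?scale1r ?diff0 ?addr0 // (conc_coc (conc_in cF 1) cF) oppr0.
Qed.

(** Induction on the number of generators in [L], those not yet known to be torsion. *)
Lemma kills_generated (n : nat) (X : cplx R) (L T : hseq X) :
  size L = n -> allL (@coc R X) L -> allL (@torsion X) T -> gen (L ++ T) ->
  exists r, r != 0 /\ cplx_kills NP r X.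
Proof.
elim: n X L T => [|n IH] X [|[i z] L] T //=.
  by move=> _ _; apply: kills_all_torsion.
move=> [sL] [cz cL] tT gLT.
have [tz|ntz] := EM (torsion z).
  apply: (IH X L (homog z :: T)) => //= P sP Pbd /allL_cat [PL [Pz PT]].
  by apply: gLT => //=; split=> //; apply/allL_cat.
have [cF] := conc_cplxP R i; have [f fE] := conc_map cF cz.
have [||||r [r0 kr]] := IH (cone f) (map (hmap (cone_in f)) L) (map (hmap (cone_in f)) T).
- by rewrite size_map.
- by apply/allL_hmap; apply: allL_impl cL => j x; apply: cm_coc.
- apply/allL_hmap; apply: allL_impl tT => j x [cx [r [r0 bx]]].
  split; first exact: cm_coc.
  by exists r; split=> //; rewrite -linearZ; apply: cm_bd.
- by rewrite -map_cat; apply: (gen_cone fE cz ntz).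
by exists r; split=> //; apply/(cplx_kills_wk NP r (wk_cone_in NP f (N_conc i))).
Qed.

Lemma kills_fgH (X : cplx R) : fgH X -> exists r, r != 0 /\ cplx_kills NP r X.
Proof.
by move=> [L [cL gL]]; apply: (@kills_generated _ X L [::]) => //; rewrite cats0.
Qed.

End TorsionFree.

(** * The singularity category *)

Section Absorption.
Variable R : comNzRingType.

Definition zero_absorbing (C : lincat R) : Prop :=
  forall (X Y Z : C) (f : Defs.hom X Y), heq (compm (zerom Y Z) f) (zerom X Z).

Lemma homotopy_zero_absorbing : zero_absorbing (homotopy_category R).
Proof. by move=> X Y Z f; apply: htp_ext. Qed.

(** For a formal inverse of s, write the zero morphism as 0 s first. *)
Lemma verdier_zero_absorbing (T : tricat R) (N : T -> Prop) :
  zero_absorbing T -> zero_absorbing (verdier N).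
Proof.
move=> abs X Y Z p; elim: p Z => {X Y} [X Y f|X Y s w|X Y V p IHp q IHq] Z /=.
- exact: loc_eq_trans (loc_eq_sym (loc_eq_in_comp _ _ _)) (loc_eq_in _ (abs _ _ _ f)).
- have e := loc_eq_in N (abs _ _ Z s).
  apply: loc_eq_trans (loc_eq_comp (loc_eq_sym e) (loc_eq_refl _)) _.
  apply: loc_eq_trans (loc_eq_comp (loc_eq_in_comp _ _ _) (loc_eq_refl _)) _.
  apply: loc_eq_trans (loc_eq_sym (loc_eq_assoc _ _ _)) _.
  apply: loc_eq_trans (loc_eq_comp (loc_eq_refl _) (loc_eq_invr w)) _.
  exact: loc_eq_idr.
- apply: loc_eq_trans (loc_eq_assoc _ _ _) _.
  exact: loc_eq_trans (loc_eq_comp (IHp Z) (loc_eq_refl _)) (IHq Z).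
Qed.

End Absorption.

Section Singularity.
Variables (R : comNzRingType) (noeth : noetherian R).
Let K := homotopy_category R.
Let D := derived_category R.
Let Df := derived_category_f R.
Let Sg := singularity_category R.
Let N := @perf_fg R.
Let NP : tri_stable N := perf_fg_tri_stable noeth.
Let LK := homotopy_laws R.
Let LD : cat_laws D := verdier_laws (@acyclic R : K -> Prop) LK.
Let perf_f : Df -> Prop := fun X => thick (T := D) (ring_cplx R) (sval X).

Let rhoK := frac_rrep NP.

Lemma fracK_inv (X Y : K) (s : Defs.hom X Y) :
  has_cone_in (T := K) (@acyclic R) s -> invertible rhoK s.
Proof.
move=> /has_cone_acyclic; apply: conj_invertible => X1 Y1 u /cone_qis qu.
exact/frac_invertible/(wk_qis NP).
Qed.

Lemma fracK_refl (X Y : K) (s : Defs.hom X Y) :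
  has_cone_in (T := K) (@acyclic R) s -> null_reflecting (rho := rhoK) (@frac_null R N) s.
Proof.
move=> /has_cone_acyclic [X' [Y' [u [a [b [/cone_qis qu Ia Ib e]]]]]].
apply: (null_reflecting_conj (frac_presheaf NP) Ia Ib e).
exact/frac_null_reflecting/(wk_qis NP).
Qed.

Let rhoD : rrep D := loc_rrep fracK_inv.
Let pshD := loc_presheaf fracK_inv (frac_presheaf NP) fracK_refl.

(** The weak map need not lie in the full subcategory of complexes with finitely
    generated cohomology, so the conjugation takes place in the derived category. *)
Lemma has_cone_perf (X Y : Df) (s : Defs.hom X Y) :
  has_cone_in perf_f s -> conj_to (C := D) (wkD N) (s : @Defs.hom R D (sval X) (sval Y)).
Proof.
elim=> {X Y s} [X Y Z f g h fgh tZ|X Y s _ IH].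
  apply: (exact_conj (@perf_fg_iso R) fgh); split=> //.
  exact/fgH_of_fg/(svalP Z).
by apply: (conj_to_shift LD) IH => X1 Y1 u; apply: wkD_shift.
Qed.

Lemma wkD_invertible (X Y : D) (u : Defs.hom X Y) : wkD N u -> invertible rhoD u.
Proof. by move=> [v [Nv ->]]; case: (frac_invertible NP Nv) => *; split. Qed.

Let rhoF : rrep Df := full_rrep _ _ rhoD.

Lemma fracF_inv (X Y : Df) (s : Defs.hom X Y) : has_cone_in perf_f s -> invertible rhoF s.
Proof.
move=> /has_cone_perf /(conj_invertible wkD_invertible) [*]; by split.
Qed.

Lemma fracF_refl (X Y : Df) (s : Defs.hom X Y) : has_cone_in perf_f s ->
  null_reflecting (rho := rhoF) (fun X => @frac_null R N (sval X)) s.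
Proof.
move=> /has_cone_perf [X' [Y' [u [a [b [[v [Nv ->]] Ia Ib e]]]]]].
have refl_v : @null_reflecting R D rhoD (@frac_null R N) X' Y' (loc_in (T := K) (@acyclic R) v).
  by move=> x y; refine (@frac_null_reflecting R N NP X' Y' v Nv x y).
exact: (null_reflecting_conj pshD Ia Ib e refl_v).
Qed.

Let pshF :=
  full_presheaf (T := D) (@fg_total_cohomology_dsum R) (@fg_total_cohomology_shift R) pshD.

Let rhoS : rrep Sg := loc_rrep fracF_inv.
Let nullS (X : Sg) := @frac_null R N (sval X).
Let scaleS (r : R) (X : Sg) := @frac_scale R r (sval X).

Lemma sing_presheaf : @presheaf R Sg rhoS nullS scaleS.
Proof. exact: (@loc_presheaf R Df perf_f rhoF fracF_inv nullS scaleS pshF fracF_refl). Qed.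

Lemma derived_exact (X Y Z : D) (p : Defs.hom X Y) (q : Defs.hom Y Z) r :
  exact_tri p q r -> @exact_at R D rhoD (@frac_null R N) X Y Z p q.
Proof.
exact: (@loc_exact_at R K (@acyclic R) rhoK fracK_inv _ _ (frac_presheaf NP) fracK_refl
  (@frac_exact R N NP)).
Qed.

Lemma derived_f_exact (X Y Z : Df) (p : Defs.hom X Y) (q : Defs.hom Y Z) r :
  exact_tri p q r -> @exact_at R Df rhoF nullS X Y Z p q.
Proof. exact: derived_exact. Qed.

Lemma sing_exact (X Y Z : Sg) (p : Defs.hom X Y) (q : Defs.hom Y Z) r :
  exact_tri p q r -> @exact_at R Sg rhoS nullS X Y Z p q.
Proof.
exact: (@loc_exact_at R Df perf_f rhoF fracF_inv nullS scaleS pshF fracF_refl derived_f_exact).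
Qed.

Lemma sing_zero_null (X : Sg) (x : car rhoS X) : rrel rhoS (zerom X X) x x -> nullS x.
Proof. by move=> e; refine (@frac_zero_null R N NP (sval X) (sval X) x x e). Qed.

Lemma sing_killsE r (X : Sg) :
  @kills R Sg rhoS nullS scaleS r X <-> cplx_kills NP r (sval X).
Proof. by []. Qed.

(** All that the induction over thickenings uses of the fraction functor. *)
Lemma sing_representation :
  exists (rho : rrep Sg) (null : forall X : Sg, car rho X -> Prop)
    (scale : R -> forall X : Sg, car rho X -> car rho X),
  [/\ presheaf null scale,
      forall (X Y Z : Sg) (p : Defs.hom X Y) (q : Defs.hom Y Z) r,
        exact_tri p q r -> exact_at null p q,
      forall (X : Sg) (x : car rho X), rrel rho (zerom X X) x x -> null X x
    & forall r (X : Sg), kills null scale r X <-> cplx_kills NP r (sval X)].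
Proof.
exists rhoS, nullS, scaleS; split.
- exact: sing_presheaf.
- exact: sing_exact.
- exact: sing_zero_null.
- exact: sing_killsE.
Qed.

Lemma kills_thickn r (G : Sg) (n : nat) (X : Sg) :
  cplx_kills NP r (sval G) -> thickn n G X -> cplx_kills NP (r ^+ n) (sval X).
Proof.
have [rho [null [scale [psh ex zn kE]]]] := sing_representation.
have k0 s (Y : Sg) : is_zero Y -> cplx_kills NP s (sval Y).
  by move=> zY; apply/kE => y /(psh_scale psh s)/(rel_heq _ _ zY)/zn.
have k1 s (H Y : Sg) : cplx_kills NP s (sval H) -> thick1 H Y -> cplx_kills NP s (sval Y).
  move=> kH; elim=> {Y}.
  - exact: kH.
  - by move=> Y _; apply: cplx_kills_shift.
  - by move=> Y _; apply: cplx_kills_unshift.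
  - by move=> Y; apply: k0.
  - by move=> Y Z _ kY _ kZ; apply: cplx_kills_dsum.
  - move=> Y Z [Y' YZ] _ /kE/(kills_iso psh YZ)/kE kYY'.
    exact: (@cplx_kills_dsuml R N NP s (sval Y) (sval Y') kYY').
move=> kG; elim: n X => [|[|n] IH] X; first exact: k0.
  exact: k1.
move=> [Y1 [Y' [Y2 [f [g [h [fgh tY1 tY2]]]]]]].
have /kE kY1 := IH _ tY1; have /kE kY2 := k1 _ _ _ kG tY2.
have /kE kYY' := kills_extension psh (ex _ _ _ _ _ _ fgh) kY1 kY2.
by rewrite exprS; exact: (@cplx_kills_dsuml R N NP _ (sval X) (sval Y') kYY').
Qed.

(** Both [r] and 0 composed with the weak map [a] are zero, and [a] is invertible. *)
Lemma sing_kills_scale r (X : Df) : cplx_kills NP r (sval X) ->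
  loc_eq (loc_in perf_f (scalem r (idm (l := Df) X))) (loc_in perf_f (zerom (l := Df) X X)).
Proof.
move=> /cplx_killsP [W [a [[tC fC] a0]]].
have fX := svalP X.
have fW : fg_total_cohomology W.
  by apply/fg_of_fgH/(ts_cocone (fgH_tri_stable noeth) (f := a)) => //; apply: fgH_of_fg.
pose W' : Df := exist _ W fW.
pose C' : Df := exist _ (cone a) (fg_of_fgH fC).
pose s : @Defs.hom R Df X W' := loc_in (T := K) (@acyclic R) a.
have w : has_cone_in perf_f s.
  apply: (@has_cone R Df perf_f X W' C' s) tC.
  exact: (loc_in_exact (T := K) (@acyclic R) LK (cone_exact a)).
have inE (U V Z : K) (g : Defs.hom V Z) (f : Defs.hom U V) :=
  loc_eq_sym (loc_eq_in_comp (T := K) (@acyclic R) g f).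
have s0 : heq (l := Df) (compm (l := Df) s (zerom (l := Df) X X)) (zerom (l := Df) X W').
  apply: loc_eq_trans (inE _ _ _ _ _) _; apply: loc_eq_in.
  by apply: htp_ext => i x; apply: cm0.
have sr : heq (l := Df)
    (compm (l := Df) s (scalem (l := Df) r (idm (l := Df) X))) (zerom (l := Df) X W').
  apply: loc_eq_trans (loc_eq_comp (loc_eq_refl _) (inE _ _ _ _ _)) _.
  apply: loc_eq_trans (inE _ _ _ _ _) _; apply: loc_eq_in.
  apply: htp_trans a0; apply: htp_ext => i x; exact: linearZ.
have K2 (f : @Defs.hom R Df X X) : heq (l := Df) (compm (l := Df) s f) (zerom (l := Df) X W') ->
    loc_eq (loc_in perf_f f) (loc_comp (loc_inv w) (loc_in perf_f (zerom (l := Df) X W'))).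
  move=> sf; apply: loc_eq_trans (loc_eq_sym (loc_eq_idl _)) _.
  apply: loc_eq_trans (loc_eq_comp (loc_eq_sym (loc_eq_invl w)) (loc_eq_refl _)) _.
  apply: loc_eq_trans (loc_eq_sym (loc_eq_assoc _ _ _)) _.
  apply: loc_eq_comp (loc_eq_refl _) _.
  apply: loc_eq_trans (loc_eq_sym (loc_eq_in_comp _ _ _)) _.
  exact: loc_eq_in.
exact: loc_eq_trans (K2 _ sr) (loc_eq_sym (K2 _ s0)).
Qed.

Lemma sing_kills_annihilator r : (forall X : Sg, cplx_kills NP r (sval X)) -> annihilator Sg r.
Proof.
move=> kr X f.
have absD : zero_absorbing Df.
  by move=> U V W; apply: (verdier_zero_absorbing (@homotopy_zero_absorbing R)).
have abs := verdier_zero_absorbing (N := perf_f) absD.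
exact: loc_eq_trans (loc_eq_comp (sing_kills_scale (kr X)) (loc_eq_refl f)) (abs _ _ _ f).
Qed.

End Singularity.

Theorem corollary4p11 (R : idomainType) (hR : noetherian R)
    (hG : exists G : singularity_category R, strong_generator G) :
  exists r : R, r != 0 /\ annihilator (singularity_category R) r.
Proof.
have [G [n genG]] := hG.
have [r [r0 kG]] := kills_fgH (perf_fg_tri_stable hR) (fun i => perf_fg_conc i hR)
  (fgH_of_fg (svalP G)).
exists (r ^+ n); split; first by rewrite expf_neq0.
apply: sing_kills_annihilator => X; exact: kills_thickn kG (genG X).
Qed.
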